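(* Let $f$ be a field of characteristic $0$, $\lambda,\mu\in f$, and let $m$ be a non-negative integer. (1) If $\mu\ne(m+k+1)\lambda$ for all positive integers $k$, then the orbits in general position of the standard representation of $G_{m+1}$ in $F_{\lambda\mu}$ can be parametrized by $m+1$ numbers $c_0\in f^*=f\setminus\{0\}$, $c_1,\dots,c_m\in f$: they are the affine planes of codimension $m+1$ given by the equations $x_0=c_0,\ x_1=c_1,\dots,x_m=c_m$. (2) If $\lambda\ne0$ and $\mu=(m+k+1)\lambda$ for a positive integer $k$, then the orbits in general position of the standard representation of $G_{m+1}$ in $F_{\lambda\mu}$ can be parametrized by $m+2$ numbers $c_0\in f^*$, $c_1,\dots,c_m,c_{m+1}\in f$: they are the affine varieties of codimension $m+2$ given by the equations $x_0=c_0,\ x_1=c_1,\dots,x_m=c_m$ together with $P_{mk}^{(-1/\lambda)}(x_0,x_1,\dots,x_{m+k})=c_{m+1}$ if $-1/\lambda\ne n$ for every positive integer $n<k$, or $P_{mk}^{(-1/\lambda)}(x_0,x_1,\dots,x_{m+k})/x_0^{k-n}=c_{m+1}$ if $-1/\lambda=n$ for a positive integer $n<k$. (3) Each orbit in general position of the standard representation of $G_{m+1}$ in $F_{\lambda\mu}$ is an orbit of the standard representation of $G_{m+1}$ in $F_{\lambda,\mu-i}$ for each nonnegative integer $i$. (4) Each orbit of the standard representation of $G_{m+1}$ in $F_{\lambda\mu}$ is an orbit in general position of the standard representation of $G_{m+1}$ in $F_{\lambda,\mu+i}$ for a nonnegative integer $i$, with the only exception when $\lambda=0$ and $\mu$ is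 a non-positive integer: then the sets $c+\mathcal O$ are also orbits, for any $c\in f^*$ and any orbit in general position $\mathcal O$ of the standard representation of $G_{m+1}$ in $F_{0i}$ for a positive integer $i$.
   Context: $F_{\lambda\mu}=f[[t]]\,t^\mu(dt)^{-\lambda}$ is the topological $f$-space with topological basis $e_k=t^{k+\mu}(dt)^{-\lambda}$, $k=0,1,2,\dots$; $x_k$ ($k\ge0$) is the linear form giving the coefficient of $e_k$. For a nonnegative integer $i$, $F_{\lambda,\mu}\subseteq F_{\lambda,\mu-i}$ naturally. For $m\ge0$, $G_{m+1}$ is the group of automorphisms $g$ of $f((t))$ over $f$ with $g(t)=t+o(t^{m+1})$, where $o(t^{m+1})$ denotes a series with all terms of degree $>m+1$; its standard representation in $F_{\lambda\mu}$ is $g\cdot\big(h(t)t^\mu(dt)^{-\lambda}\big)=h(g(t))\left(\frac{g(t)}{t}\right)^{\mu}\left(\frac{dg(t)}{dt}\right)^{-\lambda}t^\mu(dt)^{-\lambda}$, powers of series with constant term $1$ being defined by the binomial series. An orbit in $F_{\lambda\mu}$ is ''in general position'' if $x_0\ne0$ on it. For $\lambda\neq 0$ the polynomials $P_{mk}^{(-1/\lambda)}$ are defined by $$\sum_{k=1}^{\infty}P_{mk}^{(-1/\lambda)}(x_0,x_1,\dots,x_{m+k})z^k=\frac{\left(\sum_{i=0}^{\infty}x_ix_0^{i-1}z^i\right)^{-1/\lambda}-\left(\sum_{i=0}^{m}x_ix_0^{i-1}z^i\right)^{-1/\lambda}}{x_0^mz^m},$$ where the series have constant term $1$ in $z$ and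 powers are given by the binomial series.
   Formalization: In (4) the orbit {0} is excluded: it has x_0 = 0 in every F_{λ,μ+i}, so it is never in general position and the literal claim fails for it; in the exceptional case each nonzero orbit is in general position in some F_{0,μ+i} or is a set c+O. *)

(* Defs.v *)
From HB Require Import structures.
From mathcomp Require Import all_boot all_order all_algebra.
From mathcomp Require Import boolp classical_sets functions.
From mathcomp Require mpoly.

Set Implicit Arguments.
Unset Strict Implicit.
Unset Printing Implicit Defensive.

Import GRing.Theory.

Local Open Scope classical_set_scope.
Local Open Scope ring_scope.

(* The wrapper keeps the Cauchy product apart from the pointwise product that
   mathcomp.classical puts on functions. *)
Record fps (f : fieldType) := Fps { coefs :> nat -> f }.

HB.instance Definition _ (f : fieldType) := [isNew for @coefs f].
HB.instance Definition _ (f : fieldType) := [Choice of fps f by <:].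

Section PowerSeriesRing.
Variable f : fieldType.
Implicit Types (a b c : fps f) (n : nat) (k : f).

Lemma fpsP a b : a =1 b -> a = b.
Proof. by move=> ab; apply: val_inj; apply/funext. Qed.

Definition fps_zero : fps f := Fps (fun _ => 0).
Definition fps_opp a : fps f := Fps (fun n => - a n).
Definition fps_add a b : fps f := Fps (fun n => a n + b n).
Definition fps_const k : fps f := Fps (fun n => if n == 0%N then k else 0).
Definition fps_mul a b : fps f :=
  Fps (fun n => \sum_(i < n.+1) a i * b (n - i)%N).
Definition fps_scale k a : fps f := Fps (fun n => k * a n).

Fact fps_addA : associative fps_add.
Proof. by move=> a b c; apply: fpsP => n /=; rewrite addrA. Qed.
Fact fps_addC : commutative fps_add.
Proof. by move=> a b; apply: fpsP => n /=; rewrite addrC. Qed.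
Fact fps_add0 : left_id fps_zero fps_add.
Proof. by move=> a; apply: fpsP => n /=; rewrite add0r. Qed.
Fact fps_addN : left_inverse fps_zero fps_opp fps_add.
Proof. by move=> a; apply: fpsP => n /=; rewrite addNr. Qed.

HB.instance Definition _ :=
  GRing.isZmodule.Build (fps f) fps_addA fps_addC fps_add0 fps_addN.

Let trunc n a : {poly f} := \poly_(i < n) a i.

Let coef_trunc_mul n N a b : (n < N)%N ->
  fps_mul a b n = (trunc N a * trunc N b)`_n.
Proof.
move=> nN; rewrite coefM /=; apply: eq_bigr => i _.
rewrite !coef_poly (leq_ltn_trans (leq_ord i) nN).
by rewrite (leq_ltn_trans (leq_subr i n) nN).
Qed.

Fact fps_mulC : commutative fps_mul.
Proof.
move=> a b; apply: fpsP => n.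
by rewrite !(coef_trunc_mul _ _ (ltnSn n)) mulrC.
Qed.

Fact fps_mulA : associative fps_mul.
Proof.
move=> a b c; apply: fpsP => n.
transitivity ((trunc n.+1 a * trunc n.+1 b * trunc n.+1 c)`_n).
  rewrite -mulrA coefM /=; apply: eq_bigr => i _.
  rewrite coef_poly ltn_ord; congr (_ * _).
  by rewrite -coef_trunc_mul // ltnS leq_subr.
rewrite coefM /=; apply: eq_bigr => i _.
by rewrite -coef_trunc_mul // coef_poly ltnS leq_subr.
Qed.

Fact fps_mul1 : left_id (fps_const 1) fps_mul.
Proof.
move=> a; apply: fpsP => n /=; rewrite big_ord_recl /= mul1r subn0.
by rewrite big1 ?addr0 // => i _; rewrite mul0r.
Qed.

Fact fps_mulDl : left_distributive fps_mul fps_add.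
Proof.
move=> a b c; apply: fpsP => n /=; rewrite -big_split /=.
by apply: eq_bigr => i _; rewrite mulrDl.
Qed.

Fact fps_1neq0 : fps_const 1 != 0 :> fps f.
Proof.
by apply/eqP => /(congr1 (fun a : fps f => a 0%N))/eqP; rewrite /= oner_eq0.
Qed.

HB.instance Definition _ := GRing.Zmodule_isComNzRing.Build (fps f)
  fps_mulA fps_mulC fps_mul1 fps_mulDl fps_1neq0.

Fact fps_scaleA k l a : fps_scale k (fps_scale l a) = fps_scale (k * l) a.
Proof. by apply: fpsP => n /=; rewrite mulrA. Qed.
Fact fps_scale1 : left_id 1 fps_scale.
Proof. by move=> a; apply: fpsP => n /=; rewrite mul1r. Qed.
Fact fps_scaleDr : right_distributive fps_scale +%R.
Proof. by move=> k a b; apply: fpsP => n /=; rewrite mulrDr. Qed.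
Fact fps_scaleDl a : {morph fps_scale^~ a : k l / k + l}.
Proof. by move=> k l; apply: fpsP => n /=; rewrite mulrDl. Qed.

HB.instance Definition _ := GRing.Zmodule_isLmodule.Build f (fps f)
  fps_scaleA fps_scale1 fps_scaleDr fps_scaleDl.

Definition fps_unit : pred (fps f) := fun a => `[< exists b, b * a = 1 >].
Definition fps_inv a : fps f := xget a [set b | b * a = 1].

Fact fps_mulV : {in fps_unit, left_inverse 1 fps_inv *%R}.
Proof.
move=> a /asboolP[b ba]; rewrite /fps_inv.
by case: xgetP => [c _ //|/(_ b)] /(_ ba).
Qed.
Fact fps_unitP a b : b * a = 1 -> fps_unit a.
Proof. by move=> ba; apply/asboolP; exists b. Qed.
Fact fps_inv_out : {in [predC fps_unit], fps_inv =1 id}.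
Proof.
move=> a /asboolP na; rewrite /fps_inv.
by case: xgetP => // c _ /= ca; case: na; exists c.
Qed.

HB.instance Definition _ := GRing.ComNzRing_hasMulInverse.Build (fps f)
  fps_mulV fps_unitP fps_inv_out.

Let order a : a != 0 -> exists n, a n != 0 /\ forall i, (i < n)%N -> a i = 0.
Proof.
move=> a0; have ex : exists n, a n != 0.
  apply: contrapT => /forallNP ex; move/eqP: a0; apply.
  by apply: fpsP => n; apply/eqP/negPn/negP/ex.
case: (ex_minnP ex) => n an minn; exists n; split=> // i; apply: contraTeq.
by rewrite -leqNgt; apply: minn.
Qed.

Fact fps_idomain : GRing.integral_domain_axiom (fps f).
Proof.
move=> a b ab0; apply: contrapT => /negP.
rewrite negb_or => /andP[/order[p [ap ltp]] /order[q [bq ltq]]].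
have := congr1 (fun c : fps f => c (p + q)%N) ab0 => /eqP; apply/negP => /=.
have lp : (p < (p + q).+1)%N by rewrite ltnS leq_addr.
rewrite (bigD1 (Ordinal lp)) //= addKn big1 ?addr0 ?mulf_neq0 // => i ip.
case: (ltngtP i p) => [/ltp->|pi|/eqP e]; first by rewrite mul0r.
  by rewrite ltq ?mulr0 // ltn_subLR ?ltn_add2r // -ltnS ltn_ord.
by move: ip; rewrite -val_eqE /= e.
Qed.

HB.instance Definition _ :=
  GRing.ComUnitRing_isIntegral.Build (fps f) fps_idomain.

End PowerSeriesRing.

Section PowerSeriesCalculus.
Variable f : fieldType.
Implicit Types (a g h u : fps f).

Definition fps_t : fps f := Fps (fun n => (n == 1%N)%:R).

Definition fps_trunc (m : nat) a : fps f :=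
  Fps (fun n => if (n <= m)%N then a n else 0).

Definition fps_deriv a : fps f := Fps (fun n => a n.+1 *+ n.+1).

(* h(g(t)), for g without constant term: then g ^+ j only has terms of degree
   at least j, so that each coefficient is a finite sum. *)
Definition fps_comp h g : fps f :=
  Fps (fun n => \sum_(j < n.+1) h j * (g ^+ j) n).

(* (1 + t)^a *)
Definition binomial_series (a : f) : fps f :=
  Fps (fun j => (\prod_(i < j) (a - i%:R)) / j`!%:R).

(* u^a, for u with constant term 1 *)
Definition fps_pow (a : f) u : fps f := fps_comp (binomial_series a) (u - 1).

End PowerSeriesCalculus.

Notation laurent f := {fraction (fps f)}.
Notation "a %:F" := (FracField.tofrac a) : ring_scope.

Section Laurent.
Variable f : fieldType.

(* The inverse, on f[[t]], of the embedding of f[[t]] into f((t)). *)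
Definition to_fps (y : laurent f) : fps f := xget 0 [set a | a%:F = y].

Record laurent_aut := LaurentAut {
  laurent_aut_fun :> {rmorphism laurent f -> laurent f};
  laurent_aut_bij : bijective laurent_aut_fun;
  laurent_aut_const : forall k : f,
    laurent_aut_fun (fps_const k)%:F = (fps_const k)%:F }.

(* The group G_n of automorphisms g with g(t) = t + o(t^n). *)
Definition Ggroup (n : nat) : set laurent_aut :=
  [set g | exists r : fps f, (forall i, (i <= n)%N -> r i = 0) /\
     g (fps_t f)%:F = (fps_t f)%:F + r%:F].

End Laurent.

(* h : Fspace lam mu stands for h(t) t^mu (dt)^(-lam); the topological basis is
   e_k = t^(k+mu) (dt)^(-lam), and the linear form x_k is v |-> v k. *)
Definition Fspace (f : fieldType) (lam mu : f) : Type := fps f.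

HB.instance Definition _ (f : fieldType) (lam mu : f) :=
  GRing.Lmodule.copy (Fspace lam mu) (fps f).

Section Representation.
Variable f : fieldType.
Implicit Types lam mu : f.

Definition Fcoord lam mu (k : nat) (v : Fspace lam mu) : f := coefs v k.

(* h t^mu = (t^i h) t^(mu-i) *)
Definition Fincl lam mu (i : nat) (v : Fspace lam mu) :
    Fspace lam (mu - i%:R) :=
  (fps_t f ^+ i * v : fps f).

Definition std_rep lam mu (g : laurent_aut f) (v : Fspace lam mu) :
    Fspace lam mu :=
  let T := (fps_t f)%:F in
  let gt := to_fps (g T) in
  (fps_comp v gt * fps_pow mu (to_fps (g T / T))
     * fps_pow (- lam) (fps_deriv gt) : fps f).

Definition is_orbit lam mu (n : nat) (O : set (Fspace lam mu)) : Prop :=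
  exists v : Fspace lam mu, O = [set std_rep g v | g in @Ggroup f n].

Definition is_gp_orbit lam mu (n : nat) (O : set (Fspace lam mu)) : Prop :=
  is_orbit n O /\ forall v, O v -> Fcoord 0 v != 0.

End Representation.

Arguments is_orbit {f} lam mu n O.
Arguments is_gp_orbit {f} lam mu n O.

Section Equations.
Variable f : fieldType.
Implicit Types lam mu : f.

(* P_{mk}^{(a)} evaluated at the coordinates x_0, x_1, ... of v, for x_0 <> 0;
   dividing by z^m turns the coefficient of z^(m+k) into that of z^k. *)
Definition Pmk lam mu (a : f) (m k : nat) (v : Fspace lam mu) : f :=
  let x i := Fcoord i v in
  let S : fps f := Fps (fun i => x i * x 0%N ^ (i%:Z - 1)) in
  (fps_pow a S - fps_pow a (fps_trunc m S)) (m + k)%N / x 0%N ^+ m.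

Definition coord_plane lam mu (m : nat) (c : 'rV[f]_m.+1) :
    set (Fspace lam mu) :=
  [set v | forall i : 'I_m.+1, Fcoord i v = c ord0 i].

Definition coord_variety lam mu (m : nat) (Q : Fspace lam mu -> f)
    (c : 'rV[f]_m.+2) : set (Fspace lam mu) :=
  [set v | (forall i : 'I_m.+1, Fcoord i v = c ord0 (widen_ord (leqnSn _) i))
           /\ Q v = c ord0 ord_max].

(* A coset of a subspace W such that F / W has dimension d. *)
Definition affine_plane_codim lam mu (d : nat) (A : set (Fspace lam mu)) : Prop :=
  exists (L : {linear Fspace lam mu -> 'rV[f]_d}) (b : 'rV[f]_d),
    (forall y, exists v, L v = y) /\ A = [set v | L v = b].

(* A nonempty zero set of d polynomials in finitely many coordinates, whose
   differentials are linearly independent at every point of the set. *)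
Definition affine_variety_codim lam mu (d : nat) (A : set (Fspace lam mu)) : Prop :=
  exists (N : nat) (p : 'I_d -> mpoly.mpoly N f),
    let pt (v : Fspace lam mu) (i : 'I_N) := Fcoord i v in
    [/\ A !=set0,
        A = [set v | forall j, mpoly.meval (pt v) (p j) = 0]
      & forall v, A v ->
          row_free (\matrix_(j < d, i < N)
                      mpoly.meval (pt v) (mpoly.mderiv i (p j)))].

(* c + O inside F_{0,-j}, for O in F_{0,i}: the scalar c is there the element
   (c t^j) t^(-j). *)
Definition const_translate (i j : nat) (c : f) (O : set (Fspace 0 (i%:R : f))) :
    set (Fspace 0 (- j%:R : f)) :=
  [set ((fps_const c * fps_t f ^+ j : fps f) + (Fincl (i + j) w : fps f) : fps f)
     | w in O].

End Equations.

Arguments Pmk {f lam mu} a m k v.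
Arguments coord_plane {f} lam mu m c.
Arguments coord_variety {f} lam mu m Q c.
Arguments affine_plane_codim {f} lam mu d A.
Arguments affine_variety_codim {f} lam mu d A.
Arguments const_translate {f} i j c O.

(* Main.v *)
From HB Require Import structures.
Require Import Defs.
From mathcomp Require Import all_boot all_order all_algebra ring.
From mathcomp Require Import boolp classical_sets functions.
From mathcomp Require Import (canonicals) mpoly.

Set Implicit Arguments.
Unset Strict Implicit.
Unset Printing Implicit Defensive.

Import GRing.Theory.

Local Open Scope classical_set_scope.
Local Open Scope ring_scope.

(** Since the representation only sees u = g(t), its orbits are those of the
    substitutions v |-> v(u) (u/t)^mu (u')^(-lam), where u = t + o(t^(m+1)).
    Two facts about this action carry the classification.

    Transitivity up to resonances.  Adding k t^(n+1) to u, with n > m, leaves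
    the coefficients of the image below t^n unchanged and adds
    k v_0 (mu - (n+1) lam) to the one at t^n ([subst_act_variation]).  If
    v_0 <> 0, the coefficients of u can therefore be chosen one after the other
    so that v is sent to any w with the same first m+1 coefficients, except
    that nothing can be done at t^n when mu = (n+1) lam
    ([subst_act_transitive]).  The first m+1 coefficients are invariants, hence
    part (1).

    The residue.  If mu = (n+1) lam with lam <> 0, which happens for one n at
    most, then v t^mu (dt)^(-lam) is the (-lam)-th power of the differential
    form h(t) t^(-n-1) dt with h = v^(-1/lam).  The residue of this form, which
    is the coefficient of h at t^n, is invariant ([residue_invariant],
    [residue_subst_act]).  It is affine in v_n with nonzero slope
    ([residue_variation]): its invariance forces the coefficient of the image
    at t^n to take the right value precisely where the substitution has no
    influence on it ([orbit_resonant]).  The polynomial P_mk is, up to a power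
    of x_0, the residue minus a function of x_0, ..., x_m ([PmkE]), hence part
    (2).  The affine dependence on x_n also gives the codimension
    ([residue_variety_codim]).

    Parts (3) and (4) come from the equality u^i (u/t)^(mu-i) = t^i (u/t)^mu
    ([subst_act_tX]): multiplication by t^i maps orbits to orbits, and every
    nonzero series is t^i times a series with nonzero constant term.

    The substitutions are realized by automorphisms of f((t)) because each u
    has a compositional inverse, which is again obtained from transitivity, for
    lam = 0 and mu = 1 ([tangent_comp_inv], [tangent_automorphism]).  The
    powers u^a are handled through the equation u y' = a u' y that
    characterizes them ([pow_unique]). *)

Arguments coefs : simpl never.

(** * Coefficients and congruences modulo powers of t *)

Section Coefficients.
Variable f : fieldType.
Implicit Types (a b c g h u : fps f) (k : f) (n : nat).

Lemma coefsD a b n : (a + b) n = a n + b n. Proof. by []. Qed.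
Lemma coefsN a n : (- a) n = - a n. Proof. by []. Qed.
Lemma coefs0 n : (0 : fps f) n = 0. Proof. by []. Qed.
Lemma coefs_const k n : fps_const k n = if n == 0%N then k else 0.
Proof. by []. Qed.
Lemma coefs_t n : fps_t f n = (n == 1%N)%:R. Proof. by []. Qed.
Lemma coefs_Fps (F : nat -> f) n : Fps F n = F n. Proof. by []. Qed.
Lemma coefs_deriv a n : fps_deriv a n = a n.+1 *+ n.+1. Proof. by []. Qed.

Definition fps_shift a : fps f := Fps (fun n => a n.+1).

Lemma coefs_shift a n : fps_shift a n = a n.+1. Proof. by []. Qed.

Lemma coefs1 n : (1 : fps f) n = (n == 0%N)%:R.
Proof. by rewrite [LHS]coefs_const; case: (n == 0%N). Qed.

Definition coefsE :=
  (coefs0, coefs1, coefsD, coefsN, coefs_const, coefs_t, coefs_deriv,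
    coefs_shift).

Lemma coefsMn a p n : (a *+ p : fps f) n = a n *+ p.
Proof. by elim: p => [|p IH] //; rewrite !mulrS coefsD IH. Qed.

Lemma coefsM a b n : (a * b) n = \sum_(i < n.+1) a i * b (n - i)%N.
Proof. by []. Qed.

Lemma coefsM0 a b : (a * b) 0%N = a 0%N * b 0%N.
Proof. by rewrite coefsM big_ord1. Qed.

Lemma coefsCM k a n : (fps_const k * a) n = k * a n.
Proof.
rewrite coefsM big_ord_recl big1 ?addr0 ?subn0 // => i _.
by rewrite coefsE mul0r.
Qed.

Lemma fps_constM : {morph @fps_const f : k l / k * l}.
Proof.
by move=> k l; apply: fpsP => n; rewrite coefsCM !coefsE; case: eqP;
  rewrite ?mulr0.
Qed.

Lemma fps_constD : {morph @fps_const f : k l / k + l}.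
Proof.
by move=> k l; apply: fpsP => n; rewrite !coefsE; case: eqP; rewrite ?addr0.
Qed.

Lemma fps_constN : {morph @fps_const f : k / - k}.
Proof.
by move=> k; apply: fpsP => n; rewrite !coefsE; case: eqP; rewrite ?oppr0.
Qed.

Lemma fps_const_nat n : fps_const n%:R = n%:R :> fps f.
Proof.
apply: fpsP => i; rewrite coefsMn !coefsE.
by case: eqP; rewrite ?mul0rn.
Qed.

Lemma fps_constX k n : fps_const (k ^+ n) = fps_const k ^+ n.
Proof. by elim: n => [|n IH]; rewrite ?expr0 // !exprS fps_constM IH. Qed.

Lemma coefs_tM0 a : (fps_t f * a) 0%N = 0.
Proof. by rewrite coefsM0 coefsE mul0r. Qed.

Lemma coefs_tMS a n : (fps_t f * a) n.+1 = a n.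
Proof.
rewrite coefsM big_ord_recl big_ord_recl big1 ?addr0 /=.
  by rewrite !coefsE mul0r add0r mul1r subn1.
by move=> i _; rewrite coefsE mul0r.
Qed.

Lemma fps_split a : a = fps_const (a 0%N) + fps_t f * fps_shift a.
Proof.
apply: fpsP => -[|n]; rewrite !coefsE /=; first by rewrite coefs_tM0 addr0.
by rewrite coefs_tMS add0r.
Qed.

Lemma fps_shift_t a : fps_shift (fps_t f * a) = a.
Proof. by apply: fpsP => n; rewrite coefsE coefs_tMS. Qed.

Lemma fps_shiftK a : a 0%N = 0 -> fps_t f * fps_shift a = a.
Proof. by move=> a0; rewrite [RHS]fps_split a0 (fps_const_nat 0) add0r. Qed.

Lemma coefs_tXM n a i :
  (fps_t f ^+ n * a) i = if (i < n)%N then 0 else a (i - n)%N.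
Proof.
elim: n i => [|n IH] i; first by rewrite expr0 mul1r subn0.
rewrite exprS -mulrA; case: i => [|i]; first by rewrite coefs_tM0.
by rewrite coefs_tMS IH ltnS subSS.
Qed.

Lemma coefs_tX n i : (fps_t f ^+ n) i = (i == n)%:R.
Proof.
rewrite -[_ ^+ n]mulr1 coefs_tXM coefs1 subn_eq0.
by case: ltngtP.
Qed.

Lemma fps_t_neq0 : fps_t f != 0.
Proof.
by apply/eqP => /(congr1 (fun a : fps f => a 1%N))/eqP;
  rewrite !coefsE oner_eq0.
Qed.

(** Congruence modulo t^n. *)
Definition eqt n a b := forall i, (i < n)%N -> a i = b i.

Lemma eqt_sym n a b : eqt n a b -> eqt n b a.
Proof. by move=> h i /h. Qed.

Lemma eqt_trans n a b c : eqt n a b -> eqt n b c -> eqt n a c.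
Proof. by move=> h k i ni; rewrite h // k. Qed.

Lemma eqt_leq n p a b : (n <= p)%N -> eqt p a b -> eqt n a b.
Proof. by move=> np h i ni; apply: h; apply: leq_trans np. Qed.

Lemma eqtD n a b c d : eqt n a b -> eqt n c d -> eqt n (a + c) (b + d).
Proof. by move=> h k i ni; rewrite !coefsD h // k. Qed.

Lemma eqtM n a b c d : eqt n a b -> eqt n c d -> eqt n (a * c) (b * d).
Proof.
move=> h k i ni; rewrite !coefsM; apply: eq_bigr => j _.
by rewrite (h j) ?(k (i - j)%N) ?(leq_ltn_trans _ ni) ?leq_subr ?leq_ord.
Qed.

Lemma eqtX n a b p : eqt n a b -> eqt n (a ^+ p) (b ^+ p).
Proof. by move=> h; elim: p => // p IH; rewrite !exprS; apply: eqtM. Qed.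

Lemma eqt_shift n a b : eqt n.+1 a b -> eqt n (fps_shift a) (fps_shift b).
Proof. by move=> h i ni; apply: h. Qed.

Lemma eqt_eq a b : (forall n, eqt n a b) -> a = b.
Proof. by move=> h; apply: fpsP => n; apply: (h n.+1). Qed.

Lemma coefsM_valuation n x a : eqt n x 0 -> (x * a) n = x n * a 0%N.
Proof.
move=> hx; rewrite coefsM big_ord_recr /= big1 ?add0r ?subnn // => j _.
by rewrite hx ?mul0r.
Qed.

(** The other terms of the convolution only involve coefficients on which the
    factors agree, so that the Leibniz rule is exact at t^n. *)
Lemma coefsM_variation n a a' b b' :
  (0 < n)%N -> eqt n a a' -> eqt n b b' ->
  (a * b) n - (a' * b') n = (a n - a' n) * b 0%N + a 0%N * (b n - b' n).
Proof.
move=> n0 ha hb.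
rewrite -coefsN -coefsD.
have -> : a * b - a' * b' = (a - a') * b + (b - b') * a' by ring.
have ea : eqt n (a - a') 0 by move=> i /ha; rewrite !coefsE => ->;
  rewrite subrr.
have eb : eqt n (b - b') 0 by move=> i /hb; rewrite !coefsE => ->;
  rewrite subrr.
rewrite coefsD (coefsM_valuation b ea) (coefsM_valuation a' eb) !coefsE.
by rewrite -(ha 0%N) // [a 0%N * _]mulrC.
Qed.

(** Iterating the hypothesis shows that D h is divisible by every power of g.
    Applied to the difference D of the two sides of an identity between
    functions of h, this reduces the multiplicativity and the associativity of
    composition, the Leibniz rule and the chain rule to the effect of the
    decomposition h = h_0 + t h1. *)
Lemma fps_contraction (D : fps f -> fps f) g :
  g 0%N = 0 -> (forall h, D h = g * D (fps_shift h)) -> forall h, D h = 0.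
Proof.
move=> g0 hD h; apply: eqt_eq => n.
elim: n h => [|n IH] h //; rewrite hD => i; rewrite ltnS => ni.
rewrite coefsM big1 // => -[[|j] /= jn] _; first by rewrite g0 mul0r.
by rewrite IH ?mulr0 // ltn_subLR // addSn ltnS (leq_trans ni) ?leq_addl.
Qed.

End Coefficients.

(** * Composition *)

Section Composition.
Variable f : fieldType.
Implicit Types (a b c g h u w : fps f) (k : f) (n : nat).

Lemma coefs_exp_small g n p : g 0%N = 0 -> (p < n)%N -> (g ^+ n) p = 0.
Proof.
move=> g0 pn; rewrite -(fps_shiftK g0) exprMn_comm ?coefs_tXM ?pn //.
exact: mulrC.
Qed.

Lemma coefs_comp h g n N : g 0%N = 0 -> (n < N)%N ->
  fps_comp h g n = \sum_(j < N) h j * (g ^+ j) n.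
Proof.
move=> g0 nN; rewrite coefs_Fps -(subnKC nN) big_split_ord /=.
rewrite [X in _ = _ + X]big1 ?addr0 // => i _.
by rewrite coefs_exp_small ?mulr0 // addSn ltnS leq_addr.
Qed.

Lemma fps_comp_coefs0 h g : fps_comp h g 0%N = h 0%N.
Proof. by rewrite coefs_Fps big_ord1 expr0 coefs1 mulr1. Qed.

(** Horner's rule: it makes composition amenable to [fps_contraction]. *)
Lemma fps_comp_split h g : g 0%N = 0 ->
  fps_comp h g = fps_const (h 0%N) + g * fps_comp (fps_shift h) g.
Proof.
move=> g0; apply: fpsP => n.
rewrite coefsD coefs_Fps big_ord_recl expr0.
congr (_ + _); first by rewrite !coefsE; case: eqP; rewrite ?mulr1 ?mulr0.
rewrite coefsM.
transitivity (\sum_(l < n.+1) g l *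
    \sum_(j < n) h j.+1 * (g ^+ j) (n - l)%N); last first.
  apply: eq_bigr => -[[|l] ln] _ /=; first by rewrite g0 !mul0r.
  rewrite (@coefs_comp _ g _ n) //.
  by rewrite ltn_subLR // addSn ltnS leq_addl.
under [RHS]eq_bigr do rewrite mulr_sumr.
rewrite exchange_big; apply: eq_bigr => j _.
rewrite exprS coefsM mulr_sumr.
by apply: eq_bigr => l _; rewrite mulrCA.
Qed.

Lemma fps_compD g : {morph @fps_comp f ^~ g : h k / h + k}.
Proof.
move=> h k; apply: fpsP => n; rewrite coefsD !coefs_Fps -big_split /=.
by apply: eq_bigr => j _; rewrite coefsD mulrDl.
Qed.

Lemma fps_comp_const k g : fps_comp (fps_const k) g = fps_const k.
Proof.
apply: fpsP => n; rewrite coefs_Fps big_ord_recl expr0 big1 ?addr0.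
  by rewrite !coefsE /=; case: (n == 0%N); rewrite ?mulr1 ?mulr0.
by move=> i _; rewrite coefsE mul0r.
Qed.

Lemma fps_compCM k h g :
  fps_comp (fps_const k * h) g = fps_const k * fps_comp h g.
Proof.
apply: fpsP => n; rewrite coefsCM !coefs_Fps mulr_sumr; apply: eq_bigr => j _.
by rewrite coefsCM mulrA.
Qed.

Lemma fps_compN g : {morph @fps_comp f ^~ g : h / - h}.
Proof.
move=> h; have -> : - h = fps_const (-1) * h.
  by rewrite fps_constN (fps_const_nat f 1) mulN1r.
by rewrite fps_compCM fps_constN (fps_const_nat f 1) mulN1r.
Qed.

Lemma fps_compB g : {morph @fps_comp f ^~ g : h k / h - k}.
Proof. by move=> h k; rewrite fps_compD fps_compN. Qed.

Lemma fps_comp1 g : fps_comp 1 g = 1.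
Proof. exact: fps_comp_const. Qed.

Lemma fps_comptM h g : g 0%N = 0 -> fps_comp (fps_t f * h) g = g * fps_comp h g.
Proof.
move=> g0; rewrite fps_comp_split // fps_shift_t coefs_tM0.
by rewrite (fps_const_nat _ 0) add0r.
Qed.

Lemma fps_comp_t g : g 0%N = 0 -> fps_comp (fps_t f) g = g.
Proof. by move=> g0; rewrite -[fps_t f]mulr1 fps_comptM // fps_comp1 mulr1. Qed.

Lemma fps_comp_id h : fps_comp h (fps_t f) = h.
Proof.
apply: subr0_eq; move: h.
apply: (@fps_contraction _ (fun h => fps_comp h (fps_t f) - h) (fps_t f)) => //.
move=> h; rewrite {2}[h]fps_split fps_comp_split //.
by rewrite mulrBr opprD addrACA subrr add0r.
Qed.

Lemma fps_compM g : g 0%N = 0 -> {morph @fps_comp f ^~ g : h k / h * k}.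
Proof.
move=> g0 h k; apply: subr0_eq; move: h.
apply: (@fps_contraction _ (fun h =>
  fps_comp (h * k) g - fps_comp h g * fps_comp k g) g) => // h.
rewrite {1}[h]fps_split mulrDl fps_compD fps_compCM -mulrA fps_comptM //
  (fps_comp_split h) //.
ring.
Qed.

Lemma fps_compX g h n : g 0%N = 0 -> fps_comp (h ^+ n) g = fps_comp h g ^+ n.
Proof.
by move=> g0; elim: n => [|n IH]; rewrite ?fps_comp1 // !exprS fps_compM // IH.
Qed.

Lemma fps_compA h g w : g 0%N = 0 -> w 0%N = 0 ->
  fps_comp (fps_comp h g) w = fps_comp h (fps_comp g w).
Proof.
move=> g0 w0; have gw0 : fps_comp g w 0%N = 0 by rewrite fps_comp_coefs0.
apply: subr0_eq; move: h; apply: (@fps_contraction _ (fun h =>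
  fps_comp (fps_comp h g) w - fps_comp h (fps_comp g w)) _ gw0) => h.
rewrite (fps_comp_split h g0) (fps_comp_split h gw0) fps_compD fps_comp_const
  fps_compM //.
ring.
Qed.

Lemma eqt_comp n h g g' : eqt n g g' -> eqt n (fps_comp h g) (fps_comp h g').
Proof.
move=> gg i ni; rewrite !coefs_Fps; apply: eq_bigr => j _.
by rewrite (eqtX j gg).
Qed.

(** As g has no constant term, the powers g^j with j > 1 only involve, at t^n,
    coefficients of g below t^n. *)
Lemma coefs_comp_variation n h g g' : (0 < n)%N -> g 0%N = 0 -> eqt n g g' ->
  fps_comp h g n - fps_comp h g' n = h 1%N * (g n - g' n).
Proof.
move=> n0 g0 gg; have g0' : g' 0%N = 0 by rewrite -gg.
rewrite (fps_comp_split h g0) (fps_comp_split h g0') !coefsD.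
rewrite opprD addrACA subrr add0r (coefsM_variation n0 gg).
  by rewrite g0 mul0r addr0 fps_comp_coefs0 mulrC.
exact: eqt_comp.
Qed.

Lemma coefs_comp_scale h k n :
  fps_comp h (fps_const k * fps_t f) n = k ^+ n * h n.
Proof.
have coefs_kX j : ((fps_const k * fps_t f) ^+ j) n = k ^+ j * (n == j)%:R.
  rewrite exprMn_comm; last exact: mulrC.
  by rewrite -fps_constX coefsCM coefs_tX.
rewrite coefs_Fps big_ord_recr /= big1 ?add0r => [|i _].
  by rewrite coefs_kX eqxx mulr1 mulrC.
by rewrite coefs_kX gtn_eqF ?mulr0.
Qed.

End Composition.

(** * Derivatives *)

Section Derivative.
Variable f : fieldType.
Implicit Types (a b c g h u w : fps f) (k : f) (n : nat).

Lemma fps_derivD : {morph @fps_deriv f : a b / a + b}.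
Proof. by move=> a b; apply: fpsP => n; rewrite !coefsE mulrnDl. Qed.

Lemma fps_deriv_const k : fps_deriv (fps_const k) = 0.
Proof. by apply: fpsP => n; rewrite !coefsE mul0rn. Qed.

Lemma fps_derivCM k a : fps_deriv (fps_const k * a) = fps_const k * fps_deriv a.
Proof. by apply: fpsP => n; rewrite coefsCM !coefsE coefsCM mulrnAr. Qed.

Lemma fps_deriv_tM a : fps_deriv (fps_t f * a) = a + fps_t f * fps_deriv a.
Proof.
apply: fpsP => -[|n]; rewrite coefsE coefs_tMS coefsD ?coefs_tM0 ?addr0 //.
by rewrite coefs_tMS coefsE mulrS.
Qed.

Lemma fps_deriv_split a :
  fps_deriv a = fps_shift a + fps_t f * fps_deriv (fps_shift a).
Proof.
by rewrite {1}[a]fps_split fps_derivD fps_deriv_const add0r fps_deriv_tM.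
Qed.

Lemma fps_derivM a b : fps_deriv (a * b) = fps_deriv a * b + a * fps_deriv b.
Proof.
apply: subr0_eq; move: a; apply: (@fps_contraction _ (fun a =>
  fps_deriv (a * b) - (fps_deriv a * b + a * fps_deriv b)) (fps_t f)) => // a.
have e : fps_deriv (a * b) = fps_const (a 0%N) * fps_deriv b
    + fps_shift a * b + fps_t f * fps_deriv (fps_shift a * b).
  by rewrite {1}[a]fps_split mulrDl fps_derivD fps_derivCM -mulrA fps_deriv_tM
    addrA.
rewrite e (fps_deriv_split a) {6}[a]fps_split; ring.
Qed.

Lemma fps_deriv_comp h g : g 0%N = 0 ->
  fps_deriv (fps_comp h g) = fps_comp (fps_deriv h) g * fps_deriv g.
Proof.
move=> g0; apply: subr0_eq; move: h; apply: (@fps_contraction _ (fun h =>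
  fps_deriv (fps_comp h g) - fps_comp (fps_deriv h) g * fps_deriv g) g) => // h.
rewrite (fps_comp_split h g0) fps_derivD fps_deriv_const add0r fps_derivM.
rewrite (fps_deriv_split h) fps_compD fps_comptM //.
ring.
Qed.

Lemma eqt_deriv n a b : eqt n.+1 a b -> eqt n (fps_deriv a) (fps_deriv b).
Proof. by move=> h i ni; rewrite !coefsE h. Qed.

End Derivative.

(** * Powers with exponents in f *)

Section Powers.
Variable f : fieldType.
Hypothesis charf : [pchar f] =i pred0.
Implicit Types (a b k : f) (u v y g : fps f) (n : nat).

Lemma natrS_neq0 n : n.+1%:R != 0 :> f.
Proof. by rewrite ((pcharf0P f).1 charf). Qed.

Lemma coefs_subr1 u : u 0%N = 1 -> (u - 1) 0%N = 0.
Proof. by move=> u0; rewrite !coefsE u0 subrr. Qed.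

Lemma coefs_binomialS a n :
  binomial_series a n.+1 *+ n.+1 = (a - n%:R) * binomial_series a n.
Proof.
rewrite !coefs_Fps big_ord_recr factS natrM -[LHS]mulr_natr.
have := natrS_neq0 n; have : n`!%:R != 0 :> f.
  by have := fact_gt0 n; case: n`! => // p _; apply: natrS_neq0.
move: n.+1%:R (n`!%:R) => s r r0 s0 /=.
by field; rewrite r0 s0.
Qed.

Lemma deriv_binomial a :
  (1 + fps_t f) * fps_deriv (binomial_series a) =
  fps_const a * binomial_series a.
Proof.
apply: fpsP => n; rewrite mulrDl mul1r coefsCM coefsD coefs_deriv
  coefs_binomialS.
case: n => [|n]; first by rewrite coefs_tM0 addr0 subr0.
by rewrite coefs_tMS coefs_deriv -[X in _ + X]mulr_natl -mulrDl subrK.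
Qed.

Lemma pow_coefs0 a u : fps_pow a u 0%N = 1.
Proof. by rewrite fps_comp_coefs0 coefs_Fps big_ord0 invr1 mulr1. Qed.

Lemma pow_neq0 a u : fps_pow a u != 0.
Proof.
apply/eqP => /(congr1 (fun a : fps f => a 0%N))/eqP.
by rewrite pow_coefs0 oner_eq0.
Qed.

Lemma deriv_pow a u : u 0%N = 1 ->
  u * fps_deriv (fps_pow a u) = fps_const a * (fps_deriv u * fps_pow a u).
Proof.
move=> /coefs_subr1 u0.
have du : fps_deriv (u - 1) = fps_deriv u.
  rewrite fps_derivD -[-1]/(- fps_const 1 : fps f) -fps_constN.
  by rewrite fps_deriv_const addr0.
have eu : u = fps_comp (1 + fps_t f) (u - 1) by rewrite fps_compD fps_comp1
  fps_comp_t // addrC subrK.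
rewrite /fps_pow fps_deriv_comp // du {1}eu mulrA -fps_compM // deriv_binomial.
by rewrite fps_compCM; ring.
Qed.

(** In characteristic 0 the power u^a is the solution with constant term 1 of
    u y' = a u' y, since this equation determines each coefficient of y from
    the previous ones.  The laws of exponents follow. *)
Lemma pow_unique a u y : u 0%N = 1 -> y 0%N = 1 ->
  u * fps_deriv y = fps_const a * (fps_deriv u * y) -> y = fps_pow a u.
Proof.
move=> u0 y0 hy; apply: subr0_eq.
set D := y - _; have hD : u * fps_deriv D = fps_const a * (fps_deriv u * D).
  have := deriv_pow a u0 => hp; have ey : y = D + fps_pow a u by rewrite subrK.
  move: hy; rewrite ey fps_derivD !mulrDr hp.
  by move/addIr.
apply: eqt_eq; elim=> [|n IH] // i; rewrite ltnS leq_eqVlt => /orP[/eqP->|];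
  last exact: IH.
case: n IH => [|n] IH; first by rewrite !coefsE y0 pow_coefs0 subrr.
have /(congr1 (fun x : fps f => x n)) := hD.
have vD' : eqt n (fps_deriv D) 0.
  by move=> j jn; rewrite coefs_deriv IH // coefs0 mul0rn.
have -> : (fps_const a * (fps_deriv u * D)) n = 0.
  have hz : eqt n.+1 (fps_deriv u * D) (fps_deriv u * 0) by apply: eqtM.
  by rewrite coefsCM hz // mulr0 coefs0 mulr0.
rewrite mulrC (coefsM_valuation u vD') u0 mulr1 coefs_deriv => /eqP.
by rewrite -mulr_natr mulf_eq0 (negPf (natrS_neq0 n)) orbF => /eqP.
Qed.

Lemma fps_pow0 u : u 0%N = 1 -> fps_pow 0 u = 1.
Proof.
move=> u0; symmetry; apply: pow_unique; rewrite ?coefs1 //.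
by rewrite [fps_deriv 1]fps_deriv_const (fps_const_nat f 0) mulr0 mul0r.
Qed.

Lemma fps_pow1 u : u 0%N = 1 -> fps_pow 1 u = u.
Proof.
move=> u0; symmetry; apply: pow_unique => //.
by rewrite (fps_const_nat f 1) mul1r mulrC.
Qed.

Lemma fps_powD a b u : u 0%N = 1 -> fps_pow (a + b) u = fps_pow a u * fps_pow b
  u.
Proof.
move=> u0; symmetry; apply: pow_unique => //.
  by rewrite coefsM0 !pow_coefs0 mulr1.
have ha := deriv_pow a u0; have hb := deriv_pow b u0.
rewrite fps_derivM fps_constD.
have -> : u * (fps_deriv (fps_pow a u) * fps_pow b u +
     fps_pow a u * fps_deriv (fps_pow b u)) =
   u * fps_deriv (fps_pow a u) * fps_pow b u
   + fps_pow a u * (u * fps_deriv (fps_pow b u)) by ring.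
by rewrite ha hb; ring.
Qed.

Lemma pow_nat n u : u 0%N = 1 -> fps_pow n%:R u = u ^+ n.
Proof.
move=> u0; elim: n => [|n IH]; first by rewrite fps_pow0.
by rewrite -natr1 fps_powD // IH fps_pow1 // exprSr.
Qed.

Lemma fps_powMl a u v : u 0%N = 1 -> v 0%N = 1 ->
  fps_pow a (u * v) = fps_pow a u * fps_pow a v.
Proof.
move=> u0 v0; symmetry; apply: pow_unique.
- by rewrite coefsM0 u0 v0 mulr1.
- by rewrite coefsM0 !pow_coefs0 mulr1.
have hu := deriv_pow a u0; have hv := deriv_pow a v0.
rewrite !fps_derivM.
have -> : u * v * (fps_deriv (fps_pow a u) * fps_pow a v +
     fps_pow a u * fps_deriv (fps_pow a v)) =
   u * fps_deriv (fps_pow a u) * (v * fps_pow a v)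
   + u * fps_pow a u * (v * fps_deriv (fps_pow a v)) by ring.
by rewrite hu hv; ring.
Qed.

Lemma fps_powM a b u : u 0%N = 1 -> fps_pow (a * b) u = fps_pow b (fps_pow a u).
Proof.
move=> u0; symmetry; apply: pow_unique; rewrite ?pow_coefs0 //.
have hp := deriv_pow a u0; have hq := deriv_pow b (pow_coefs0 a u).
set p := fps_pow a u in hp hq *; set q := fps_pow b p in hq *.
apply: (mulfI (pow_neq0 a u)); rewrite -/p mulrCA hq.
have -> : u * (fps_const b * (fps_deriv p * q)) =
   fps_const b * (u * fps_deriv p * q) by ring.
by rewrite hp fps_constM; ring.
Qed.

Lemma fps_comp_pow a u g : u 0%N = 1 -> g 0%N = 0 ->
  fps_comp (fps_pow a u) g = fps_pow a (fps_comp u g).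
Proof.
by move=> u0 g0; rewrite /fps_pow fps_compA ?coefs_subr1 // fps_compB fps_comp1.
Qed.

Lemma eqt_pow n a u v : eqt n u v -> eqt n (fps_pow a u) (fps_pow a v).
Proof. by move=> uv; apply: eqt_comp; apply: eqtD. Qed.

Lemma coefs_pow_variation n a u v : (0 < n)%N -> u 0%N = 1 -> eqt n u v ->
  fps_pow a u n - fps_pow a v n = a * (u n - v n).
Proof.
move=> n0 u0 uv; rewrite coefs_comp_variation //; last 2 first.
- exact: coefs_subr1.
- exact: eqtD.
rewrite coefs_Fps big_ord1 subr0 divr1 !coefsE.
by rewrite opprD addrACA subrr addr0.
Qed.

End Powers.

(** * The action of substitutions t -> u(t) *)

Section Action.
Variable f : fieldType.
Hypothesis charf : [pchar f] =i pred0.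
Implicit Types (lam mu a b k : f) (u v w g : fps f) (m n : nat).

(** u = t + o(t^n): the exponent of the congruence exceeds by one the index of
    the group G_n. *)
Definition tangent n u := eqt n.+1 u (fps_t f).

Definition subst_act lam mu u v : fps f :=
  fps_comp v u * fps_pow mu (fps_shift u) * fps_pow (- lam) (fps_deriv u).

Lemma tangent_coefs0 n u : tangent n u -> u 0%N = 0.
Proof. by move=> h; rewrite h // coefs_t. Qed.

Lemma tangent_coefs1 n u : tangent n.+1 u -> u 1%N = 1.
Proof. by move=> h; rewrite h // coefs_t. Qed.

Lemma tangent_shift0 n u : tangent n.+1 u -> fps_shift u 0%N = 1.
Proof. exact: tangent_coefs1. Qed.

Lemma tangent_deriv0 n u : tangent n.+1 u -> fps_deriv u 0%N = 1.
Proof. by move=> h; rewrite coefsE (tangent_coefs1 h). Qed.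

Lemma tangent_t n : tangent n (fps_t f). Proof. by []. Qed.

Lemma tangent_eqt n p u u' :
  (n < p)%N -> eqt p u u' -> tangent n u -> tangent n u'.
Proof.
by move=> np uu' hu; apply: eqt_trans hu; apply: eqt_leq np _; apply: eqt_sym.
Qed.

Lemma tangent_leq n p u : (n <= p)%N -> tangent p u -> tangent n u.
Proof. by move=> np; apply: eqt_leq. Qed.

Lemma subst_act_t lam mu v : subst_act lam mu (fps_t f) v = v.
Proof.
have s1 : fps_shift (fps_t f) = 1 by rewrite -[fps_t f]mulr1 fps_shift_t.
have d1 : fps_deriv (fps_t f) = 1.
  by rewrite -[fps_t f]mulr1 fps_deriv_tM [fps_deriv 1]fps_deriv_const mulr0
    addr0.
have p1 a : fps_pow a 1 = 1.
  symmetry; apply: pow_unique; rewrite ?coefs1 //.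
  by rewrite [fps_deriv 1]fps_deriv_const mulr0 mul0r mulr0.
by rewrite /subst_act s1 d1 !p1 fps_comp_id !mulr1.
Qed.

Lemma eqt_subst_act lam mu n u u' v :
  eqt n.+1 u u' -> eqt n (subst_act lam mu u v) (subst_act lam mu u' v).
Proof.
move=> uu'; apply: eqtM; first apply: eqtM.
- by apply: eqt_comp; apply: eqt_leq uu'.
- by apply: eqt_pow; apply: eqt_shift.
- by apply: eqt_pow; apply: eqt_deriv.
Qed.

(** The infinitesimal action: replacing u by u + k t^(n+1) changes the
    coefficients at t^n of the three factors by 0, mu k and - lam (n+1) k. *)
Lemma subst_act_variation lam mu n u u' v :
  (0 < n)%N -> tangent 1 u -> eqt n.+1 u u' ->
  subst_act lam mu u v n - subst_act lam mu u' v n =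
  v 0%N * (mu - n.+1%:R * lam) * (u n.+1 - u' n.+1).
Proof.
move=> n0 tu uu'; have tu' : tangent 1 u' by apply: tangent_eqt uu' tu.
have uu'n : eqt n u u' by apply: eqt_leq uu'.
have s01 := tangent_shift0 tu; have d01 := tangent_deriv0 tu.
have ss := eqt_shift uu'; have dd := eqt_deriv uu'.
have e1 := coefs_comp_variation v n0 (tangent_coefs0 tu) uu'n.
have e2 := coefs_pow_variation mu n0 s01 ss.
have e3 := coefs_pow_variation (- lam) n0 d01 dd.
have e12 := coefsM_variation n0 (eqt_comp v uu'n) (eqt_pow mu ss).
have e12' := eqtM (eqt_comp v uu'n) (eqt_pow mu ss).
rewrite {}e1 {}e2 pow_coefs0 fps_comp_coefs0 (uu' n (ltnSn n)) subrr in e12.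
rewrite /subst_act (coefsM_variation n0 e12' (eqt_pow (- lam) dd)) {}e12 {}e3.
rewrite coefsM0 !pow_coefs0 fps_comp_coefs0 !coefs_shift !coefs_deriv.
rewrite -(mulr_natl (u _)) -(mulr_natl (u' _)); move: (n.+1%:R) => s; ring.
Qed.

Lemma eqt_subst_act_tangent lam mu m u v :
  tangent m.+1 u -> eqt m.+1 (subst_act lam mu u v) v.
Proof.
by move=> tu; rewrite -{2}(subst_act_t lam mu v); apply: eqt_subst_act.
Qed.

Lemma subst_act_coefs0 lam mu m u v :
  tangent m.+1 u -> subst_act lam mu u v 0%N = v 0%N.
Proof. by move=> tu; apply: (eqt_subst_act_tangent _ _ _ tu). Qed.

(** The next coefficient of the substitution is chosen so as to correct the
    first coefficient of the image that is still wrong.  A resonance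
    mu = (n+1) lam leaves the coefficient at t^n out of control; the division
    by zero then leaves the substitution unchanged. *)
Fixpoint transporter lam mu m v w n : fps f :=
  if n is n'.+1 then
    let u := transporter lam mu m v w n' in
    let p := (m.+1 + n')%N in
    u + fps_const ((w p - subst_act lam mu u v p) /
                   (v 0%N * (mu - p.+1%:R * lam))) * fps_t f ^+ p.+1
  else fps_t f.

Lemma transporter_stable lam mu m v w n p : (n <= p)%N ->
  eqt (m.+2 + n)%N (transporter lam mu m v w p) (transporter lam mu m v w n).
Proof.
move=> /subnK <-; elim: (p - n)%N => [|d IH] //=.
apply: eqt_trans IH => i ni; rewrite coefsD coefsCM coefs_tX ltn_eqF ?mulr0
  ?addr0 //.
by rewrite (leq_trans ni) // !addSn !ltnS leq_add2l leq_addl.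
Qed.

(** The last hypothesis says that, at a resonance, the coefficient at t^n is
    correct as soon as the lower ones are. *)
Lemma subst_act_transitive lam mu m v w :
  v 0%N != 0 -> eqt m.+1 v w ->
  (forall n u, (m < n)%N -> mu = n.+1%:R * lam -> tangent m.+1 u ->
     eqt n (subst_act lam mu u v) w -> subst_act lam mu u v n = w n) ->
  exists2 u, tangent m.+1 u & subst_act lam mu u v = w.
Proof.
move=> v0 vw res; pose U := transporter lam mu m v w.
have tU n : tangent m.+1 (U n).
  by have := transporter_stable (m := m) lam mu v w (leq0n n); rewrite addn0.
have hU n : eqt (m.+1 + n)%N (subst_act lam mu (U n) v) w.
  elim: n => [|n IH]; first by rewrite addn0 subst_act_t.
  have UU := transporter_stable (m := m) lam mu v w (leqnSn n).
  have sUU : eqt (m.+1 + n)%N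
      (subst_act lam mu (U n.+1) v) (subst_act lam mu (U n) v).
    exact: eqt_subst_act.
  move=> i; rewrite addnS ltnS leq_eqVlt => /orP[/eqP->|]; last first.
    by move=> ni; rewrite sUU // IH.
  have := subst_act_variation lam mu v _ (tangent_leq _ (tU n.+1)) UU.
  rewrite !addSn => /(_ isT isT) /eqP; rewrite subr_eq => /eqP ->.
  have -> : U n.+1 (m + n)%N.+2 - U n (m + n)%N.+2 =
      (w (m + n)%N.+1 - subst_act lam mu (U n) v (m + n)%N.+1) /
                   (v 0%N * (mu - (m + n)%N.+2%:R * lam)).
    rewrite [U n.+1 _]coefsD -/(U n) addrC addKr coefsCM addSn coefs_tX eqxx
      mulr1.
    by [].
  have [e|ne] := eqVneq mu ((m + n)%N.+2%:R * lam).
    rewrite -e subrr mulr0 mul0r add0r; apply: res => //.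
    by rewrite ltnS leq_addr.
  rewrite mulrC divfK ?mulf_neq0 ?subr_eq0 //; exact: subrK.
(* The coefficients of the successive substitutions are eventually constant. *)
pose u : fps f := Fps (fun i => U i i).
have uU n : eqt (m.+2 + n)%N u (U n).
  move=> i ni; rewrite coefs_Fps; have [/transporter_stable|lt] := leqP n i.
    exact.
  apply/esym/transporter_stable; first exact: ltnW.
  by rewrite addSn ltnS leq_addl.
exists u; first by apply: eqt_trans (tU 0%N); rewrite -[m.+2]addn0; apply: uU.
apply: eqt_eq => n; apply: (@eqt_leq _ _ (m.+1 + n)%N); first exact: leq_addl.
by apply: eqt_trans (hU n); apply: eqt_subst_act; apply: uU.
Qed.

(** On t f[[t]], seen as the space with (lam, mu) = (0, 1) where no resonance
    occurs, substitution is transitive on the series tangent to t. *)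
Lemma tangent_comp_rinv m h : tangent m.+1 h ->
  exists2 u, tangent m.+1 u & fps_comp h u = fps_t f.
Proof.
move=> th; have s0 := tangent_shift0 th.
have sh : eqt m.+1 (fps_shift h) 1.
  have -> : (1 : fps f) = fps_shift (fps_t f).
    by rewrite -[fps_t f]mulr1 fps_shift_t.
  exact: eqt_shift.
have [|n u _ /eqP|u tu hu] := subst_act_transitive (lam := 0) (mu := 1) _ sh.
- by rewrite s0 oner_eq0.
- by rewrite mulr0 oner_eq0.
exists u => //; have u0 := tangent_coefs0 tu.
have e : fps_comp (fps_shift h) u * fps_shift u = 1.
  rewrite -hu /subst_act oppr0 (fps_pow0 charf (tangent_deriv0 tu)).
  by rewrite (fps_pow1 charf (tangent_shift0 tu)) mulr1.
rewrite -(fps_shiftK (tangent_coefs0 th)) fps_comptM //.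
by rewrite -{1}(fps_shiftK u0) -mulrA [fps_shift u * _]mulrC e mulr1.
Qed.

Lemma tangent_comp_inv m h : tangent m.+1 h ->
  exists u,
    [/\ tangent m.+1 u, fps_comp h u = fps_t f & fps_comp u h = fps_t f].
Proof.
move=> th; have [u tu hu] := tangent_comp_rinv th.
have [x tx ux] := tangent_comp_rinv tu; exists u; split=> //.
have [[h0 u0] x0] := (tangent_coefs0 th, tangent_coefs0 tu, tangent_coefs0 tx).
suff -> : h = x by [].
by rewrite -[h]fps_comp_id -ux -fps_compA // hu fps_comp_t.
Qed.

(** * The residue of a differential form *)

(** With p = u/t and u' = p + t p', the form u^(-n-2) du is the exact form
    - d (u^(-n-1)) / (n+1); it has no residue. *)
Lemma coefs_residue_one n u : tangent 1 u ->
  (fps_pow (- n.+2%:R) (fps_shift u) * fps_deriv u) n.+1 = 0.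
Proof.
move=> tu; have s0 := tangent_shift0 tu; set p := fps_shift u.
have eu : fps_deriv u = p + fps_t f * fps_deriv p.
  by rewrite -{1}(fps_shiftK (tangent_coefs0 tu)) fps_deriv_tM.
have ep : fps_pow (- n.+1%:R) p = fps_pow (- n.+2%:R) p * p.
  rewrite -{3}[p](fps_pow1 charf) // -fps_powD //.
  by congr fps_pow; rewrite -[n.+2%:R]natr1; ring.
have hD := deriv_pow charf (- n.+1%:R) s0; rewrite -/p {2}ep in hD.
have eD : fps_deriv (fps_pow (- n.+1%:R) p) =
    fps_const (- n.+1%:R) * (fps_pow (- n.+2%:R) p * fps_deriv p).
  have p0 : p != 0.
    apply/eqP => /(congr1 (fun a : fps f => a 0%N))/eqP.
    by rewrite s0 oner_eq0.
  by apply: (mulfI p0); rewrite hD; ring.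
rewrite eu mulrDr -ep mulrCA coefsD coefs_tMS.
have /(congr1 (fun a : fps f => a n))/eqP := eD.
rewrite coefsCM coefs_deriv -(mulr_natl (fps_pow _ _ _)) mulNr -mulrN => /eqP.
by move=> /(mulfI (natrS_neq0 charf n)) ->; rewrite addNr.
Qed.

(** The coefficient at t^n of v is the residue of the form v t^(-n-1) dt, which
    does not depend on the choice of the parameter.  Splitting off the constant
    term of v lowers the order of the pole, whence the induction. *)
Lemma residue_invariant n u v : tangent 1 u ->
  (fps_comp v u * fps_pow (- n.+1%:R) (fps_shift u) * fps_deriv u) n = v n.
Proof.
move=> tu; have [u0 s0] := (tangent_coefs0 tu, tangent_shift0 tu).
elim: n v => [|n IH] v.
  by rewrite !coefsM0 pow_coefs0 (tangent_deriv0 tu) fps_comp_coefs0 !mulr1.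
rewrite fps_comp_split // 2!mulrDl coefsD -mulrA coefsCM coefs_residue_one //
  mulr0 add0r.
rewrite -[v n.+1]coefs_shift -IH -{1}(fps_shiftK u0) -[RHS]coefs_tMS.
congr (coefs _ _).
have -> : fps_pow (- n.+1%:R) (fps_shift u) =
    fps_pow (- n.+2%:R) (fps_shift u) * fps_shift u.
  rewrite -{3}[fps_shift u](fps_pow1 charf) // -fps_powD //.
  by congr fps_pow; rewrite -[n.+2%:R]natr1; ring.
ring.
Qed.

End Action.

(** * Substitutions as automorphisms of f((t)) *)

Section FractionMap.
Variable R : idomainType.

Lemma fraction_num_den (y : {fraction R}) :
  exists2 x : R * R, x.2 != 0 & y = x.1%:F / x.2%:F.
Proof.
elim/quotW: y => r; exists (\n_r, \d_r) => /=; first exact: denom_ratioP.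
rewrite -[RHS]/(FracField.mul _ (FracField.inv _)) !piE.
rewrite /FracField.mulf /FracField.invf.
rewrite !numden_Ratio ?oner_eq0 ?denom_ratioP //.
by rewrite mulr1 mul1r Ratio_numden.
Qed.

(** f((t)) being the fraction field of f[[t]], a substitution extends to it as
    soon as it is injective on f[[t]]. *)
Lemma fraction_morphism (phi : {rmorphism R -> R}) : injective phi ->
  exists F : {rmorphism {fraction R} -> {fraction R}},
    forall a, F a%:F = (phi a)%:F.
Proof.
move=> phi_inj.
pose F (y : {fraction R}) :=
  let x := s2val (cid2 (fraction_num_den y)) in (phi x.1)%:F / (phi x.2)%:F.
have nz b : b != 0 -> (phi b)%:F != 0 :> {fraction R}.
  by move=> b0; rewrite tofrac_eq0 -(rmorph0 phi) (inj_eq phi_inj).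
have nzF b : b != 0 -> b%:F != 0 :> {fraction R} by rewrite tofrac_eq0.
have FE a b : b != 0 -> F (a%:F / b%:F) = (phi a)%:F / (phi b)%:F.
  move=> b0; rewrite /F; case: cid2 => -[c d] /= d0 /eqP.
  rewrite eqr_div ?nzF // -!tofracM tofrac_eq => /eqP e.
  by apply/eqP; rewrite eqr_div ?nz // -!tofracM -!rmorphM e.
have F1 a : F a%:F = (phi a)%:F.
  by rewrite -[a%:F]divr1 -tofrac1 FE ?oner_eq0 // rmorph1 tofrac1 divr1.
have FB : zmod_morphism F.
  move=> x y.
  have [[a b] /= b0 ->] := fraction_num_den x.
  have [[c d] /= d0 ->] := fraction_num_den y.
  rewrite -mulNr -tofracN addf_div ?nzF // -!tofracM -tofracD !FE ?mulf_neq0 //.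
  rewrite -[in RHS]mulNr -tofracN addf_div ?nz // -!tofracM -tofracD.
  by rewrite rmorphD !rmorphM rmorphN.
have FM : monoid_morphism F.
  split=> [|x y]; first by rewrite -tofrac1 F1 rmorph1.
  have [[a b] /= b0 ->] := fraction_num_den x.
  have [[c d] /= d0 ->] := fraction_num_den y.
  rewrite mulf_div -!tofracM !FE ?mulf_neq0 // mulf_div -!tofracM.
  by rewrite !rmorphM.
pose F' : {rmorphism {fraction R} -> {fraction R}} := HB.pack F
  (GRing.isZmodMorphism.Build _ _ F FB) (GRing.isMonoidMorphism.Build _ _ F FM).
by exists F'.
Qed.

End FractionMap.

Section Automorphisms.
Variable f : fieldType.
Hypothesis charf : [pchar f] =i pred0.
Implicit Types (lam mu : f) (u v w : fps f) (m n : nat).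

Lemma to_fpsK u : to_fps u%:F = u.
Proof.
rewrite /to_fps; case: xgetP => [a _ /eqP|/(_ u) []//].
by rewrite tofrac_eq => /eqP.
Qed.

Lemma subst_morphism u : u 0%N = 0 ->
  exists phi : {rmorphism fps f -> fps f}, forall a, phi a = fps_comp a u.
Proof.
move=> u0; pose F a := fps_comp a u.
have FB : zmod_morphism F by move=> a b; apply: fps_compB.
have FM : monoid_morphism F by split=> [|a b]; rewrite /F ?fps_comp1 ?fps_compM.
pose F' : {rmorphism fps f -> fps f} := HB.pack F
  (GRing.isZmodMorphism.Build _ _ F FB) (GRing.isMonoidMorphism.Build _ _ F FM).
by exists F'.
Qed.

Lemma subst_fraction_morphism u w : u 0%N = 0 -> w 0%N = 0 ->
  fps_comp u w = fps_t f ->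
  exists F : {rmorphism laurent f -> laurent f},
    forall a, F a%:F = (fps_comp a u)%:F.
Proof.
move=> u0 w0 uw; have [phi phiE] := subst_morphism u0.
have phi_inj : injective phi.
  move=> a b; rewrite !phiE => /(congr1 (fun x => fps_comp x w)).
  by rewrite !fps_compA // uw !fps_comp_id.
by have [F FE] := fraction_morphism phi_inj; exists F => a; rewrite FE phiE.
Qed.

Lemma tangent_automorphism m u : tangent m.+1 u ->
  exists2 g : laurent_aut f, Ggroup m.+1 g & g (fps_t f)%:F = u%:F.
Proof.
move=> tu; have [w [tw uw wu]] := tangent_comp_inv charf tu.
have [u0 w0] := (tangent_coefs0 tu, tangent_coefs0 tw).
have [F FE] := subst_fraction_morphism u0 w0 uw.
have [G GE] := subst_fraction_morphism w0 u0 wu.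
have Fbij : bijective F.
  exists G => y; have [[a b] /= _ ->] := fraction_num_den y.
    by rewrite !fmorph_div !FE !GE !fps_compA // uw !fps_comp_id.
  by rewrite !fmorph_div !GE !FE !fps_compA // wu !fps_comp_id.
have Fconst k : F (fps_const k)%:F = (fps_const k)%:F.
  by rewrite FE fps_comp_const.
have gt : LaurentAut Fbij Fconst (fps_t f)%:F = u%:F.
  by rewrite /= FE fps_comp_t.
exists (LaurentAut Fbij Fconst) => //; exists (u - fps_t f); split=> [i im|].
  by rewrite !coefsE tu // coefs_t subrr.
by rewrite gt -tofracD addrC subrK.
Qed.

Lemma std_repE lam mu m (g : laurent_aut f) : Ggroup m.+1 g ->
  exists2 u, tangent m.+1 u &
    g (fps_t f)%:F = u%:F /\
    forall v : Fspace lam mu, std_rep g v = subst_act lam mu u v.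
Proof.
case=> r [r0 gt]; have tu : tangent m.+1 (fps_t f + r).
  by move=> i; rewrite ltnS => im; rewrite coefsD r0 // addr0.
rewrite -tofracD in gt; exists (fps_t f + r) => //; split=> // v.
have quot : to_fps ((fps_t f + r)%:F / (fps_t f)%:F) = fps_shift (fps_t f + r).
  rewrite -{1}(fps_shiftK (tangent_coefs0 tu)) tofracM mulrAC divff ?mul1r.
    exact: to_fpsK.
  by rewrite tofrac_eq0 fps_t_neq0.
by rewrite /std_rep gt to_fpsK quot.
Qed.

(** Only g(t) enters the representation, and every series tangent to t occurs:
    the orbits are those of the substitutions. *)
Lemma orbitE lam mu m (v : Fspace lam mu) :
  [set std_rep g v | g in @Ggroup f m.+1] =
  [set subst_act lam mu u v | u in tangent m.+1].
Proof.
apply/seteqP; split=> w [].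
  move=> g /(std_repE lam mu) [u tu [_ gu]] <-; exists u => //; exact/esym/gu.
move=> u /tangent_automorphism [g Gg gt] <-; exists g => //.
have [u' _ [gt' ->]] := std_repE lam mu Gg; congr subst_act.
by apply/eqP; rewrite -tofrac_eq -gt' gt.
Qed.

Lemma is_orbitP lam mu m (O : set (Fspace lam mu)) :
  is_orbit lam mu m.+1 O <->
  exists v : fps f, O = [set subst_act lam mu u v | u in tangent m.+1].
Proof. by split=> -[v ->]; exists v; rewrite orbitE. Qed.

Lemma is_gp_orbitP lam mu m (O : set (Fspace lam mu)) :
  is_gp_orbit lam mu m.+1 O <->
  exists2 v : fps f, v 0%N != 0 &
    O = [set subst_act lam mu u v | u in tangent m.+1].
Proof.
split=> [[/is_orbitP[v ->] O0]|[v v0 ->]].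
  exists v => //; rewrite -(subst_act_t charf lam mu v);
    apply: (O0 (subst_act _ _ _ _)).
  exact: imageP.
split; first by apply/is_orbitP; exists v.
by move=> _ [u tu <-]; rewrite /Fcoord (subst_act_coefs0 charf _ _ _ tu).
Qed.

End Automorphisms.

(** * Inclusions between the representations *)

Section Inclusions.
Variable f : fieldType.
Hypothesis charf : [pchar f] =i pred0.
Implicit Types (lam mu k : f) (u v w : fps f) (m n i j : nat).

(** The factor u^i that the substitution produces out of t^i is t^i (u/t)^i. *)
Lemma subst_act_tX lam mu i u v : tangent 1 u ->
  subst_act lam (mu - i%:R) u (fps_t f ^+ i * v) =
  fps_t f ^+ i * subst_act lam mu u v.
Proof.
move=> tu; have [u0 s0] := (tangent_coefs0 tu, tangent_shift0 tu).
rewrite /subst_act fps_compM // fps_compX // fps_comp_t //.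
have -> : fps_pow mu (fps_shift u) =
    fps_pow (mu - i%:R) (fps_shift u) * fps_shift u ^+ i.
  by rewrite -{1}(subrK i%:R mu) -pow_nat // -fps_powD.
have -> : u ^+ i = fps_t f ^+ i * fps_shift u ^+ i.
  by rewrite -{1}(fps_shiftK u0) exprMn_comm //; apply: mulrC.
ring.
Qed.

Lemma incl_orbit lam mu m i v :
  [set fps_t f ^+ i * w | w in [set subst_act lam mu u v | u in tangent m.+1]] =
  [set subst_act lam (mu - i%:R) u (fps_t f ^+ i * v) | u in tangent m.+1].
Proof.
apply/seteqP; split=> [_ [_ [u tu <-] <-]|_ [u tu <-]].
  by exists u => //; apply/subst_act_tX/tangent_leq/tu.
exists (subst_act lam mu u v); first by exists u.
by apply/esym/subst_act_tX/tangent_leq/tu.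
Qed.

Lemma fps_valuation v : v <> 0 ->
  exists i w, w 0%N != 0 /\ v = fps_t f ^+ i * w.
Proof.
move=> v0; have ex : exists n, v n != 0.
  apply: contrapT => /forallNP ex; apply: v0.
  by apply: fpsP => n; apply/eqP/negPn/negP/ex.
case: (ex_minnP ex) => i vi mini; exists i, (Fps (fun n => v (n + i)%N)).
split=> //; apply: fpsP => n; rewrite coefs_tXM coefs_Fps.
case: ltnP => [ni|/subnK->//]; apply/eqP; apply: contraTT ni => /mini.
by rewrite -leqNgt.
Qed.

Lemma is_orbit_incl lam mu m (O : set (Fspace lam mu)) :
  is_orbit lam mu m.+1 O -> O <> [set 0] ->
  exists i (O' : set (Fspace lam (mu + i%:R))),
    is_gp_orbit lam (mu + i%:R) m.+1 O' /\ O = [set Fincl i v | v in O'].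
Proof.
move=> /(is_orbitP charf)[v ->] O0.
have [i [w [w0 ev]]] : exists i w, w 0%N != 0 /\ v = fps_t f ^+ i * w.
  apply: fps_valuation => v0; apply: O0; rewrite v0.
  have act0 u : subst_act lam mu u 0 = 0.
    have -> : 0 = fps_const 0 :> fps f by rewrite (fps_const_nat f 0).
    by rewrite /subst_act fps_comp_const (fps_const_nat f 0) !mul0r.
  apply/seteqP; split=> [_ [u _ <-]|_ ->] /=; first exact: act0.
  by exists (fps_t f); [apply: tangent_t|apply: act0].
exists i, [set subst_act lam (mu + i%:R) u w | u in tangent m.+1]; split.
  by apply/is_gp_orbitP => //; exists w.
by rewrite [RHS]incl_orbit addrK -ev.
Qed.

(** When lam = 0 the constant functions are fixed by every substitution, so that
    translating by one of them commutes with the action. *)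
Lemma const_translate_orbit m i j k (O : set (Fspace 0 (i%:R : f))) :
  is_gp_orbit 0 i%:R m.+1 O ->
  is_orbit 0 (- j%:R) m.+1 (const_translate i j k O).
Proof.
move=> /(is_gp_orbitP charf)[v v0 ->]; apply/is_orbitP => //.
exists (fps_t f ^+ j * fps_const k + fps_t f ^+ (i + j) * v).
have act u : tangent m.+1 u ->
  subst_act 0 (- j%:R) u (fps_t f ^+ j * fps_const k + fps_t f ^+ (i + j) * v) =
  fps_const k * fps_t f ^+ j + fps_t f ^+ (i + j) * subst_act 0 i%:R u v.
  move=> tu; have t1 : tangent 1 u by apply: tangent_leq tu.
  rewrite -(subst_act_tX _ _ _ _ t1) natrD opprD addrA subrr sub0r.
  rewrite {1}/subst_act fps_compD !mulrDl -!/(subst_act _ _ _ _); congr (_ + _).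
  have := subst_act_tX 0 0 j (fps_const k) t1; rewrite sub0r => ->.
  rewrite /subst_act oppr0 !fps_pow0 ?(tangent_shift0 t1) ?(tangent_deriv0 t1)
    //.
  by rewrite fps_comp_const !mulr1 mulrC.
apply/seteqP; split=> [_ [_ [u tu <-] <-]|_ [u tu <-]].
  by exists u => //; apply: act.
by exists (subst_act 0 i%:R u v); [exists u|rewrite act].
Qed.

End Inclusions.

(** * Orbits in general position *)

Section Classification.
Variable f : fieldType.
Hypothesis charf : [pchar f] =i pred0.
Implicit Types (lam mu a : f) (u v w : fps f) (m n k i e : nat).

Local Notation orbit lam mu m v :=
  [set subst_act lam mu u v | u in tangent m.+1].

Lemma orbit_nonresonant lam mu m v :
  (forall k, (0 < k)%N -> mu <> (m + k + 1)%:R * lam) -> v 0%N != 0 ->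
  orbit lam mu m v = [set w | eqt m.+1 w v].
Proof.
move=> nores v0; apply/seteqP; split=> [_ [u tu <-]|w vw] /=.
  exact: eqt_subst_act_tangent.
have [||n u mn e|u tu hu] := @subst_act_transitive _ charf lam mu m v w.
- exact: v0.
- exact: eqt_sym.
- case: (nores (n - m)%N); first by rewrite subn_gt0.
  by rewrite subnKC ?(ltnW mn) // addn1.
by exists u.
Qed.

Definition fps_normalize v := fps_const (v 0%N)^-1 * v.

(** The powers of v with exponents in f only make sense when v_0 = 1; dividing
    by the invariant v_0 multiplies the form by a constant. *)
Definition residue a n v := fps_pow a (fps_normalize v) n.

Lemma normalize_coefs0 v : v 0%N != 0 -> fps_normalize v 0%N = 1.
Proof. by move=> v0; rewrite coefsCM mulVf. Qed.

Lemma eqt_normalize n v w : v 0%N = w 0%N -> eqt n v w ->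
  eqt n (fps_normalize v) (fps_normalize w).
Proof. by rewrite /fps_normalize => -> vw; apply: eqtM. Qed.

Lemma residue_variation a n v w :
  (0 < n)%N -> v 0%N != 0 -> eqt n v w ->
  residue a n v - residue a n w = a * ((v n - w n) / v 0%N).
Proof.
move=> n0 v0 vw; have vw0 := vw 0%N n0.
rewrite /residue coefs_pow_variation ?normalize_coefs0 //.
  by rewrite !coefsCM -vw0 -mulrBr [_^-1 * _]mulrC.
exact: eqt_normalize.
Qed.

(** At a resonance mu = (n+1) lam the representation sends v to v^(-1/lam), up
    to a constant factor, equivariantly into the forms h t^(-n-1) dt. *)
Lemma residue_subst_act lam mu m n u v :
  lam != 0 -> mu = n.+1%:R * lam -> v 0%N != 0 -> tangent m.+1 u ->
  residue (- lam^-1) n (subst_act lam mu u v) = residue (- lam^-1) n v.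
Proof.
move=> lam0 emu v0 tu; have t1 : tangent 1 u by apply: tangent_leq tu.
have u0 := tangent_coefs0 t1.
have [s0 d0] := (tangent_shift0 t1, tangent_deriv0 t1).
rewrite /residue -[RHS](residue_invariant charf _ _ t1); congr (coefs _ _).
have -> : fps_normalize (subst_act lam mu u v) =
    fps_comp (fps_normalize v) u * fps_pow mu (fps_shift u)
    * fps_pow (- lam) (fps_deriv u).
  rewrite /fps_normalize (subst_act_coefs0 charf _ _ _ tu) fps_compCM.
  by rewrite /subst_act -!mulrA.
have n0 := normalize_coefs0 v0.
have c0 : fps_comp (fps_normalize v) u 0%N = 1 by rewrite fps_comp_coefs0.
move: (fps_normalize v) n0 c0 => nv n0 c0.
rewrite !fps_powMl ?coefsM0 ?c0 ?pow_coefs0 ?mulr1 //.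
rewrite -!fps_powM // fps_comp_pow // mulrNN mulfV // fps_pow1 //.
by rewrite emu mulrN mulfK.
Qed.

Lemma orbit_resonant lam mu m n v :
  lam != 0 -> mu = n.+1%:R * lam -> (m < n)%N -> v 0%N != 0 ->
  orbit lam mu m v =
  [set w | eqt m.+1 w v /\ residue (- lam^-1) n w = residue (- lam^-1) n v].
Proof.
move=> lam0 emu mn v0; apply/seteqP; split=> [_ [u tu <-]|w [wv rw]] /=.
  split; first exact: eqt_subst_act_tangent.
  exact: (residue_subst_act lam0 emu v0 tu).
have [||p u mp e tu uw|u tu hu] := @subst_act_transitive _ charf lam mu m v w.
- exact: v0.
- exact: eqt_sym.
- (* As lam <> 0, there is only one resonance. *)
  have pn : p = n.
    have /(mulIf lam0)/eqP : p.+1%:R * lam = n.+1%:R * lam by rewrite -e -emu.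
    rewrite -subr_eq0; case: (leqP p n) => [pn|np].
      rewrite -opprB oppr_eq0 -natrB ?ltnS // subSS ((pcharf0P f).1 charf).
      by rewrite subn_eq0 => np; apply/eqP; rewrite eqn_leq pn.
    rewrite -natrB ?ltnS ?(ltnW np) // subSS ((pcharf0P f).1 charf).
    by rewrite subn_eq0 leqNgt np.
  rewrite pn in uw *.
  have a0 := subst_act_coefs0 charf lam mu v tu.
  have n0 : (0 < n)%N by apply: leq_ltn_trans mn.
  have := residue_variation (- lam^-1) n0 _ uw.
  rewrite a0 => /(_ v0); rewrite (residue_subst_act lam0 emu v0 tu) rw subrr.
  move=> /esym/eqP; rewrite !mulf_eq0 oppr_eq0 !invr_eq0 (negPf lam0) (negPf
    v0).
  by rewrite orbF subr_eq0 => /eqP.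
by exists u.
Qed.

(** The series in the definition of P_mk is (v / v_0)(v_0 t): the rescaling of t
    multiplies the coefficient at t^(m+k) by v_0^(m+k), of which the division by
    v_0^m leaves v_0^k. *)
Lemma PmkE lam mu a m k (v : Fspace lam mu) : Fcoord 0 v != 0 ->
  Pmk a m k v = Fcoord 0 v ^+ k *
    (residue a (m + k) v - fps_pow a (fps_trunc m (fps_normalize v)) (m + k)%N).
Proof.
rewrite /Pmk /Fcoord => v0.
set S := Fps _; pose T := fps_const (coefs v 0%N) * fps_t f.
have T0 : T 0%N = 0 by rewrite coefsCM coefs_t mulr0.
have eS : S = fps_comp (fps_normalize v) T.
  apply: fpsP => i; rewrite coefs_comp_scale coefsCM coefs_Fps.
  by rewrite expfzDr // -exprnP exprN1 mulrA mulrC.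
have trunc_scale h : fps_trunc m (fps_comp h T) = fps_comp (fps_trunc m h) T.
  apply: fpsP => i; rewrite coefs_comp_scale !(coefs_Fps (fun _ => if _ then _
    else _)).
  by case: ifP => _; rewrite ?mulr0 // coefs_comp_scale.
have t0 : fps_trunc m (fps_normalize v) 0%N = 1.
  by rewrite coefs_Fps normalize_coefs0.
rewrite eS trunc_scale -!fps_comp_pow ?normalize_coefs0 // coefsD coefsN.
rewrite !coefs_comp_scale -mulrBr exprD mulrC -!mulrA.
by apply: mulKf; apply: expf_neq0.
Qed.

(** On the set where x_0, ..., x_m are fixed, the equation in P_mk is a
    condition on the residue alone. *)
Lemma Pmk_eq lam mu a m k e (v w : Fspace lam mu) :
  Fcoord 0 v != 0 -> eqt m.+1 w v ->
  (Pmk a m k w / Fcoord 0 w ^+ e = Pmk a m k v / Fcoord 0 v ^+ e) <->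
  residue a (m + k) w = residue a (m + k) v.
Proof.
move=> v0 wv; have w0 : Fcoord 0 w = Fcoord 0 v by apply: wv.
have et : fps_trunc m (fps_normalize w) = fps_trunc m (fps_normalize v).
  apply: fpsP => i; rewrite !coefs_Fps; case: leqP => // im.
  by apply: eqt_normalize wv _ _.
rewrite !PmkE ?w0 // et; split=> [|->//].
move=> /(mulIf _) h; have := h (invr_neq0 (expf_neq0 e v0)).
by move=> /(mulfI (expf_neq0 k v0))/addIr.
Qed.

(** A family of sets, each of them the orbit of any of its points, parametrizes
    the orbits in general position once it covers their union without
    repetition. *)
Lemma gp_orbit_bijection lam mu m (C : Type) (D : set C)
    (F : C -> set (Fspace lam mu)) :
  (forall c, D c -> exists v : fps f, F c v) ->
  (forall c (v : fps f), D c -> F c v ->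
     v 0%N != 0 /\ F c = orbit lam mu m v) ->
  (forall v : fps f, v 0%N != 0 -> exists2 c, D c & F c v) ->
  (forall c c' (v : fps f), D c -> D c' -> F c v -> F c' v -> c = c') ->
  set_bij D (is_gp_orbit lam mu m.+1) F.
Proof.
move=> Fex Forb Fcov Finj; split.
- move=> c Dc; have [v Fv] := Fex c Dc; have [v0 ->] := Forb c v Dc Fv.
  by apply/is_gp_orbitP => //; exists v.
- move=> c c'; rewrite !inE => Dc Dc' e; have [v Fv] := Fex c Dc.
  by apply: (Finj c c' v) => //; rewrite -e.
- move=> O /(is_gp_orbitP charf)[v v0 ->]; have [c Dc Fv] := Fcov v v0.
  by exists c => //; have [_ ->] := Forb c v Dc Fv.
Qed.

End Classification.

(** * The orbits as affine varieties *)

Section Varieties.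
Variable f : fieldType.
Hypothesis charf : [pchar f] =i pred0.
Implicit Types (lam mu a : f) (u v w : fps f) (m n k i e : nat).

Lemma coord_plane_codim lam mu m (c : 'rV[f]_m.+1) :
  affine_plane_codim lam mu m.+1 (coord_plane lam mu m c).
Proof.
pose L (v : Fspace lam mu) : 'rV[f]_m.+1 := \row_i Fcoord i v.
have LP : linear L by move=> k v w; apply/rowP => i; rewrite !mxE.
pose L' : {linear Fspace lam mu -> 'rV[f]_m.+1} :=
  HB.pack L (GRing.isLinear.Build _ _ _ _ L LP).
exists L', c; split=> [y|].
  exists (Fps (fun i => y ord0 (inord i)) : Fspace lam mu).
  by apply/rowP => i; rewrite mxE /Fcoord coefs_Fps inord_val.
apply/seteqP; split=> v /=.
  by move=> vc; apply/rowP => i; rewrite mxE vc.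
by move=> /rowP vc i; rewrite -vc mxE.
Qed.

Definition fps_of_poly (p : {poly f}) : fps f := Fps (fun i => p`_i).

Lemma coefs_of_poly p i : fps_of_poly p i = p`_i. Proof. by []. Qed.

Lemma fps_of_polyX p j : fps_of_poly (p ^+ j) = fps_of_poly p ^+ j.
Proof.
elim: j => [|j IH].
  by apply: fpsP => i; rewrite coefs1 coefs_of_poly coef1.
by rewrite !exprS -IH; apply: fpsP => i; rewrite coefs_of_poly coefM.
Qed.

Section Resonance.
Variables (n : nat) (a x0 : f).

Local Notation P := (mpoly.mpoly n.+1 f).
Local Notation Xv i := (mpoly.mpolyX f (mpoly.mnm1 (inord i : 'I_n.+1)) : P).

Definition lower_series : {poly P} :=
  \poly_(i < n) (if i == 0%N then 0 else x0^-1 *: Xv i).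

(** The part of the residue at t^n that does not involve x_n, for a given value
    of x_0. *)
Definition lower_residue : P :=
  \sum_(j < n.+1) binomial_series a j *: (lower_series ^+ j)`_n.

Local Notation pt v := (fun i : 'I_n.+1 => coefs v i).

Lemma meval_lower_residue v :
  mpoly.meval (pt v) lower_residue =
  fps_pow a (1 + fps_of_poly
     (\poly_(i < n) (if i == 0%N then 0 else x0^-1 * v i))) n.
Proof.
rewrite /fps_pow [1 + fps_of_poly _]addrC addrK coefs_Fps /lower_residue
  raddf_sum /=.
apply: eq_bigr => j _; rewrite mpoly.mevalZ; congr (_ * _).
rewrite -fps_of_polyX coefs_of_poly -coef_map rmorphXn /=.
congr (coefp n (_ ^+ _)); apply/polyP => i; rewrite coef_map !coef_poly /=.
case: ltnP => [ni|_]; last exact: mpoly.meval0.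
case: eqP => _; first exact: mpoly.meval0.
by rewrite mpoly.mevalZ mpoly.mevalXU inordK // ltnW.
Qed.

Lemma mderiv_lower_residue :
  mpoly.mderiv (inord n : 'I_n.+1) lower_residue = 0.
Proof.
rewrite /lower_residue raddf_sum big1 // => j _.
rewrite /= mpoly.mderivZ.
suff -> : forall i, mpoly.mderiv (inord n : 'I_n.+1) (lower_series ^+ j)`_i = 0.
  by rewrite scaler0.
elim: (j : nat) => [|p IH] i.
  by rewrite expr0 coef1 -mpoly.mpolyC_nat mpoly.mderivC.
rewrite exprS coefM raddf_sum big1 // => l _.
rewrite /= mpoly.mderivM IH mulr0 addr0 coef_poly.
case: ltnP => [ln|_]; last by rewrite mpoly.mderiv0 mul0r.
case: eqP => _; first by rewrite mpoly.mderiv0 mul0r.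
rewrite mpoly.mderivZ mpoly.mderivX mpoly.mnmE -val_eqE /= !inordK //.
  by rewrite ltn_eqF // scale0r scaler0 mul0r.
by rewrite ltnW.
Qed.

End Resonance.

(** After fixing x_0 <> 0, ..., x_m, the residue at t^n is a polynomial in the
    coordinates, affine in x_n with the nonzero slope a / x_0: its differential
    is independent of those of x_0, ..., x_m. *)
Lemma residue_variety_codim lam mu a m n v :
  a != 0 -> (m < n)%N -> v 0%N != 0 ->
  affine_variety_codim lam mu m.+2
    [set w | eqt m.+1 w v /\ residue a n w = residue a n v].
Proof.
move=> a0 mn v0; have n0 : (0 < n)%N by apply: leq_ltn_trans mn.
pose x0 := v 0%N.
pose P := mpoly.mpoly n.+1 f.
pose X i : P := mpoly.mpolyX f (mpoly.mnm1 (inord i : 'I_n.+1)).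
pose q : P := (a / x0) *: X n + lower_residue n a x0
              - mpoly.mpolyC n.+1 (residue a n v).
pose p (j : 'I_m.+2) : P :=
  if (j < m.+1)%N then X j - mpoly.mpolyC n.+1 (v j) else q.
exists n.+1, p => pt.
have mX (w : Fspace lam mu) i : (i <= n)%N ->
    mpoly.meval (pt w) (X i) = coefs w i.
  by move=> ni; rewrite mpoly.mevalXU /pt /Fcoord inordK.
have mq (w : Fspace lam mu) : coefs w 0%N = x0 ->
    mpoly.meval (pt w) q = residue a n w - residue a n v.
  move=> w0; rewrite /q mpoly.mevalB mpoly.mevalD mpoly.mevalZ mX //
    mpoly.mevalC.
  congr (_ - _); rewrite /pt /Fcoord meval_lower_residue.
  set s := fps_of_poly _; have w00 : coefs w 0%N != 0 by rewrite w0.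
  have sw : eqt n (fps_normalize w) (1 + s).
    move=> i ni; rewrite coefsCM coefsD coefs1 coefs_of_poly coef_poly ni w0.
    case: eqP => [->|_]; last by rewrite add0r.
    by rewrite w0 mulVf // addr0.
  have := coefs_pow_variation a n0 (normalize_coefs0 w00) sw.
  rewrite coefsCM coefsD coefs1 coefs_of_poly coef_poly ltnn gtn_eqF // addr0
    subr0.
  rewrite /residue => /eqP; rewrite subr_eq => /eqP ->.
  by rewrite w0 -mulrA.
split.
- by exists v.
- apply/seteqP; split=> w /=.
    move=> [wv rw] j; rewrite /p; case: ltnP => jm.
      rewrite mpoly.mevalB mX ?mpoly.mevalC //; last first.
        exact: leq_trans (ltnW mn).
      by rewrite wv // subrr.
    by rewrite mq ?rw ?subrr // wv.
  move=> zw; have wv : eqt m.+1 w v.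
    move=> i im; have := zw (inord i); rewrite /p inordK ?im; last exact: ltnW.
    rewrite mpoly.mevalB mX ?mpoly.mevalC; last exact: leq_trans (ltnW mn).
    by move/subr0_eq.
  split=> //; have := zw ord_max; rewrite /p ltnn mq; last exact: wv.
  by move/subr0_eq.
move=> w [wv _]; apply: inj_row_free => r /rowP rJ.
have dX i j : (i <= n)%N -> (j <= n)%N ->
    mpoly.meval (pt w) (mpoly.mderiv (inord i) (X j)) = (j == i)%:R.
  move=> ni nj; rewrite mpoly.mderivX mpoly.mevalZ mpoly.mnm1E -val_eqE /=
    !inordK //.
  case: eqP => [->|_]; last by rewrite mul0r.
  have -> : mpoly.mnm_sub (mpoly.mnm1 (inord i)) (mpoly.mnm1 (inord i)) =
      mpoly.mnm0 :> mpoly.multinom n.+1.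
    by apply/mpoly.mnmP => l; rewrite mpoly.mnmBE mpoly.mnm0E subnn.
  by rewrite mpoly.mpolyX0 mpoly.meval1 mulr1.
have dp i (j : 'I_m.+1) : (i <= n)%N ->
    mpoly.meval (pt w) (mpoly.mderiv (inord i) (p (widen_ord (leqnSn _) j))) =
    (j == i :> nat)%:R.
  move=> ni; rewrite /p /= ltn_ord mpoly.mderivB mpoly.mderivC subr0 dX //.
  by rewrite (leq_trans _ mn) // ltnW.
have r_last : r ord0 ord_max = 0.
  have := rJ (inord n); rewrite !mxE big_ord_recr /= big1 => [|j _]; last first.
    by rewrite mxE dp // ltn_eqF ?mulr0 // (leq_trans _ mn).
  rewrite add0r mxE /p ltnn /q mpoly.mderivB mpoly.mderivC subr0 mpoly.mderivD.
  rewrite mpoly.mderivZ mderiv_lower_residue addr0 mpoly.mevalZ dX // eqxx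
    mulr1.
  by move/eqP; rewrite !mulf_eq0 invr_eq0 (negPf a0) (negPf v0) !orbF => /eqP.
apply/rowP => j; rewrite [RHS]mxE; case: (unliftP ord_max j) => [i ->|-> //].
have im : (i <= n)%N by rewrite (leq_trans _ mn) // ltnW.
have := rJ (inord i); rewrite !mxE big_ord_recr /= r_last mul0r addr0.
rewrite (bigD1 i) //= mxE dp // eqxx mulr1 big1 => [|l li]; last first.
  by rewrite mxE dp // (_ : (l == i :> nat) = false) ?mulr0 //; apply: negPf.
rewrite addr0 => <-; congr (r _ _); apply: val_inj.
by rewrite /= /bump leqNgt ltn_ord.
Qed.

End Varieties.

(** * The two families of orbits *)

Section Families.
Variable f : fieldType.
Hypothesis charf : [pchar f] =i pred0.
Implicit Types (lam mu a : f) (u v w : fps f) (m n k i e : nat).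

Lemma nonresonant_orbits lam mu m :
  (forall k, (0 < k)%N -> mu <> (m + k + 1)%:R * lam) ->
  set_bij [set c : 'rV[f]_m.+1 | c ord0 ord0 != 0]
          (is_gp_orbit lam mu m.+1) (coord_plane lam mu m).
Proof.
move=> nores; apply: gp_orbit_bijection => //.
- move=> c _; exists (Fps (fun i => c ord0 (inord i))) => i.
  by rewrite /Fcoord coefs_Fps inord_val.
- move=> c v /= c0 cv.
  have v0 : v 0%N != 0 by have := cv ord0; rewrite /Fcoord => ->.
  split=> //; rewrite orbit_nonresonant //; apply/seteqP; split=> w /= cw.
    move=> i im; have := cv (Ordinal im); have := cw (Ordinal im).
    by rewrite /Fcoord /= => -> ->.
  by move=> i; rewrite -cv; apply: cw.
- by move=> v v0; exists (\row_i v i) => [|i]; rewrite /= mxE.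
- by move=> c c' v _ _ cv cv'; apply/rowP => i; rewrite -cv -cv'.
Qed.

Section Resonant.
Variables (lam mu : f) (m k e : nat).
Hypotheses (k0 : (0 < k)%N) (lam0 : lam != 0) (emu : mu = (m + k + 1)%:R * lam).

Let a := - lam^-1.
Let Q (v : Fspace lam mu) := Pmk a m k v / Fcoord 0 v ^+ e.

Let a0 : a != 0. Proof. by rewrite oppr_eq0 invr_eq0. Qed.
Let mk : (m < m + k)%N. Proof. by rewrite -[X in (X < _)%N]addn0 ltn_add2l. Qed.

Lemma coord_varietyE (c : 'rV[f]_m.+2) v :
  c ord0 ord0 != 0 -> coord_variety lam mu m Q c v ->
  v 0%N != 0 /\
  coord_variety lam mu m Q c =
    [set w | eqt m.+1 w v /\ residue a (m + k) w = residue a (m + k) v].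
Proof.
move=> c0 [cv Qv].
have v0 : v 0%N != 0.
  have := cv ord0; rewrite /Fcoord /= => ->;
    rewrite (_ : widen_ord _ _ = ord0) //.
  exact: val_inj.
split=> //; apply/seteqP; split=> w /=.
  move=> [cw Qw]; have wv : eqt m.+1 w v.
    move=> i im; have := cv (Ordinal im); have := cw (Ordinal im).
    by rewrite /Fcoord /= => -> ->.
  by split=> //; apply/(Pmk_eq a k e v0 wv); rewrite -[LHS]/(Q w) Qw -Qv.
move=> [wv rw]; split=> [i|]; first by rewrite -cv; apply: wv.
by rewrite -Qv; apply/(Pmk_eq a k e v0 wv).
Qed.

(** The last equation can be solved for the coordinate x_(m+k). *)
Lemma coord_variety_nonempty (c : 'rV[f]_m.+2) : c ord0 ord0 != 0 ->
  exists v : fps f, coord_variety lam mu m Q c v.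
Proof.
move=> c0.
pose v' : fps f := Fps (fun i => if (i <= m)%N then c ord0 (inord i) else 0).
pose x0 := c ord0 ord0.
pose K := fps_pow a (fps_trunc m (fps_normalize v')) (m + k)%N.
pose r := c ord0 ord_max * x0 ^+ e / x0 ^+ k + K.
(* The residue is affine in the coordinate x_(m+k), with slope a / x_0. *)
pose x := (r - residue a (m + k) v') * x0 / a.
pose v : fps f := v' + fps_const x * fps_t f ^+ (m + k).
have vv' : eqt (m + k) v v'.
  by move=> i ik; rewrite coefsD coefsCM coefs_tX ltn_eqF // mulr0 addr0.
have v'0 : v' 0%N = x0.
  by rewrite coefs_Fps /x0; congr (c _ _); apply: val_inj; rewrite /= inordK.
have v0 : v 0%N = x0 by rewrite vv' // (leq_ltn_trans _ mk).
have v0n : v 0%N != 0 by rewrite v0.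
have rv : residue a (m + k) v = r.
  have := residue_variation a (leq_ltn_trans (leq0n _) mk) v0n vv'.
  rewrite coefsD coefsCM coefs_tX eqxx mulr1 addrAC subrr add0r v0 /x.
  have solve (d b : f) : b != 0 -> b * (d * x0 / b / x0) = d.
    by move=> b0; field; rewrite b0 c0.
  by rewrite solve // => /addIr.
have tv : fps_trunc m (fps_normalize v) = fps_trunc m (fps_normalize v').
  apply: fpsP => i; rewrite !(coefs_Fps (fun _ => if _ then _ else _)).
  case: leqP => // im; apply: (@eqt_normalize _ (m + k)); rewrite ?v0 ?v'0 //.
  exact: leq_ltn_trans mk.
exists v; split=> [i|].
  rewrite /Fcoord vv'; last by apply: leq_trans (ltn_ord i) mk.
  rewrite coefs_Fps -ltnS ltn_ord; congr (c _ _); apply: val_inj.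
  by rewrite /= inordK // ltnS ltnW.
rewrite /Q PmkE // tv -/K rv /r addrK /Fcoord v0.
have := expf_neq0 k c0; have := expf_neq0 e c0; rewrite -/x0.
by move: (x0 ^+ e) (x0 ^+ k) => y z y0 z0; field; rewrite y0 z0.
Qed.

Lemma resonant_orbits :
  set_bij [set c : 'rV[f]_m.+2 | c ord0 ord0 != 0]
          (is_gp_orbit lam mu m.+1) (coord_variety lam mu m Q) /\
  forall c : 'rV[f]_m.+2, c ord0 ord0 != 0 ->
    affine_variety_codim lam mu m.+2 (coord_variety lam mu m Q c).
Proof.
split; last first.
  move=> c c0; have [v cv] := coord_variety_nonempty c0.
  by have [v0 ->] := coord_varietyE c0 cv; apply: residue_variety_codim.
have emu' : mu = (m + k).+1%:R * lam by rewrite -addn1.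
apply: gp_orbit_bijection => //.
- by move=> c; apply: coord_variety_nonempty.
- move=> c v c0 cv; have [v0 ->] := coord_varietyE c0 cv.
  by rewrite (orbit_resonant charf lam0 emu' mk v0).
- move=> v v0.
  exists (\row_i if (i < m.+1)%N then v i else Q v) => [|/=];
    first by rewrite /= mxE.
  by split=> [i|]; rewrite mxE /= ?ltn_ord // ltnn.
- move=> c c' v _ _ [cv Qv] [cv' Qv']; apply/rowP => i.
  case: (unliftP ord_max i) => [j ->|->]; last by rewrite -Qv -Qv'.
  have -> : lift ord_max j = widen_ord (leqnSn m.+1) j.
    by apply: val_inj; rewrite /= /bump leqNgt ltn_ord.
  by rewrite -cv -cv'.
Qed.

End Resonant.
End Families.

(** * The classification of the orbits *)

Theorem theorem5 (f : fieldType) (charf : [pchar f] =i pred0)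
    (lam mu : f) (m : nat) :
  (* (1) *)
  ((forall k : nat, (0 < k)%N -> mu <> (m + k + 1)%:R * lam) ->
     set_bij [set c : 'rV[f]_m.+1 | c ord0 ord0 != 0]
             (is_gp_orbit lam mu m.+1)
             (coord_plane lam mu m)
     /\ forall c : 'rV[f]_m.+1, c ord0 ord0 != 0 ->
          affine_plane_codim lam mu m.+1 (coord_plane lam mu m c))
  /\
  (* (2) *)
  (forall k : nat, (0 < k)%N -> lam <> 0 -> mu = (m + k + 1)%:R * lam ->
     ((forall n : nat, (0 < n < k)%N -> - lam^-1 <> n%:R) ->
        let Q v := Pmk (- lam^-1) m k v in
        set_bij [set c : 'rV[f]_m.+2 | c ord0 ord0 != 0]
                (is_gp_orbit lam mu m.+1)
                (coord_variety lam mu m Q)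
        /\ forall c : 'rV[f]_m.+2, c ord0 ord0 != 0 ->
             affine_variety_codim lam mu m.+2 (coord_variety lam mu m Q c))
     /\
     (forall n : nat, (0 < n < k)%N -> - lam^-1 = n%:R ->
        let Q v := Pmk (- lam^-1) m k v / Fcoord 0 v ^+ (k - n) in
        set_bij [set c : 'rV[f]_m.+2 | c ord0 ord0 != 0]
                (is_gp_orbit lam mu m.+1)
                (coord_variety lam mu m Q)
        /\ forall c : 'rV[f]_m.+2, c ord0 ord0 != 0 ->
             affine_variety_codim lam mu m.+2 (coord_variety lam mu m Q c)))
  /\
  (* (3) *)
  (forall O : set (Fspace lam mu), is_gp_orbit lam mu m.+1 O ->
     forall i : nat,
       is_orbit lam (mu - i%:R) m.+1 [set Fincl i v | v in O])
  /\
  (* (4) *)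
  (((~ exists j : nat, lam = 0 /\ mu = - j%:R) ->
      forall O : set (Fspace lam mu), is_orbit lam mu m.+1 O -> O <> [set 0] ->
      exists (i : nat) (O' : set (Fspace lam (mu + i%:R))),
        is_gp_orbit lam (mu + i%:R) m.+1 O' /\ O = [set Fincl i v | v in O'])
   /\
   (forall j : nat, lam = 0 -> mu = - j%:R ->
      (forall O : set (Fspace lam mu), is_orbit lam mu m.+1 O -> O <> [set 0] ->
         (exists (i : nat) (O' : set (Fspace lam (mu + i%:R))),
            is_gp_orbit lam (mu + i%:R) m.+1 O' /\ O = [set Fincl i v | v in O'])
         \/
         (exists (c : f) (i : nat) (O' : set (Fspace 0 (i%:R : f))),
            [/\ c != 0, (0 < i)%N, is_gp_orbit 0 i%:R m.+1 O'
              & O = const_translate i j c O']))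
      /\
      (forall (c : f) (i : nat) (O' : set (Fspace 0 (i%:R : f))),
         c != 0 -> (0 < i)%N -> is_gp_orbit 0 i%:R m.+1 O' ->
         is_orbit lam mu m.+1 (const_translate i j c O')))).
Proof.
split; [|split; [|split; [|split]]].
- move=> nores; split; first exact: nonresonant_orbits.
  by move=> c _; apply: coord_plane_codim.
- move=> k k0 /eqP lam0 emu; split=> [_|n _ _]; last first.
    exact: (resonant_orbits charf (k - n) k0 lam0 emu).
  have -> : (fun v : Fspace lam mu => Pmk (- lam^-1) m k v) =
      (fun v => Pmk (- lam^-1) m k v / Fcoord 0 v ^+ 0).
    by apply/funext => v; rewrite expr0 divr1.
  exact: (resonant_orbits charf 0 k0 lam0 emu).
- move=> O /(is_gp_orbitP charf)[v _ ->] i; apply/is_orbitP => //.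
  by exists (fps_t f ^+ i * v); rewrite -incl_orbit.
- by move=> _ O; apply: is_orbit_incl.
- move=> j elam emu; split=> [O orbO O0|c i O' _ _ gpO'].
    by left; apply: is_orbit_incl.
  by rewrite elam emu; apply: const_translate_orbit.
Qed.
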